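(* Let $\alpha\in\mathbb{C}$ and let $\beta,\gamma>-1$ be real numbers such that if $\beta,\gamma\in(-1,0)$ then $\beta+\gamma+1\neq 0$. Let $\rho\in\{z\in\mathbb{C}:|z|<1\}$ and $x\in(-1,1)$. Then $$\left(\frac{2}{(1-x)\rho}\right)^{\alpha/2}\left(\frac{2}{(1+x)\rho}\right)^{\beta/2}J_\alpha\!\left(\sqrt{2(1-x)\rho}\right)I_\beta\!\left(\sqrt{2(1+x)\rho}\right)$$ $$=\frac{1}{(\gamma+\beta+1)\Gamma(\alpha+1)\Gamma(\beta+1)}\sum_{k=0}^\infty\frac{(2k+\gamma+\beta+1)(\gamma+\beta+1)_k\left(\frac{\alpha+\beta+1}{2}\right)_k\left(\frac{\alpha+\beta+2}{2}\right)_k}{(\alpha+1)_k(\beta+1)_k(\alpha+\beta+1)_k\left(\frac{\gamma+\beta+2}{2}\right)_k\left(\frac{\gamma+\beta+3}{2}\right)_k}\;{}_2F_3\!\left(\begin{array}{c}2k+\alpha+\beta+1,\ \alpha-\gamma\\ \alpha+\beta+k+1,\ \gamma+\beta+2k+2,\ \alpha+k+1\end{array};\rho\right)\rho^kP_k^{(\gamma,\beta)}(x).$$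
   Context: Square roots and complex powers are principal. $(z)_n:=\prod_{i=1}^n(z+i-1)$ is the Pochhammer symbol. ${}_pF_q(a_1,\dots,a_p;b_1,\dots,b_q;z):=\sum_{n=0}^\infty\frac{(a_1)_n\cdots(a_p)_n}{(b_1)_n\cdots(b_q)_n}\frac{z^n}{n!}$. The Jacobi polynomials are $P_n^{(\alpha,\beta)}(z):=\frac{(\alpha+1)_n}{n!}\,{}_2F_1\left(-n,n+\alpha+\beta+1;\alpha+1;\frac{1-z}{2}\right)$, $n\in\mathbb{N}_0=\{0,1,2,\dots\}$. The Bessel function of the first kind and the modified Bessel function of the first kind are $J_\nu(z):=\frac{(z/2)^\nu}{\Gamma(\nu+1)}\,{}_0F_1\left(-;\nu+1;-\frac{z^2}{4}\right)$ and $I_\nu(z):=\frac{(z/2)^\nu}{\Gamma(\nu+1)}\,{}_0F_1\left(-;\nu+1;\frac{z^2}{4}\right)$, where $1/\Gamma(\nu+1)$ is absorbed into the series (as $\sum_n \frac{(\mp 1)^n (z/2)^{2n+\nu}}{n!\,\Gamma(\nu+n+1)}$, upper sign for $J_\nu$, lower for $I_\nu$) when $\nu$ is a negative integer. Interpretation: $\left(\frac{2}{w}\right)^{s}$ means $\left(\frac{w}{2}\right)^{-s}$ with the principal power, so that the left-hand side is an analytic function of $\rho$ in the unit disc; at $\rho=0$ it is defined by continuity. If $\alpha+1$ or $\alpha+\beta+1$ lies in $\{0,-1,-2,\dots\}$, the product $\frac{\left(\frac{\alpha+\beta+1}{2}\right)_k\left(\frac{\alpha+\beta+2}{2}\right)_k}{\Gamma(\alpha+1)(\alpha+1)_k(\alpha+\beta+1)_k}\,{}_2F_3(\cdots;\rho)$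 is understood as its analytic continuation in $\alpha$, namely $4^{-k}\sum_{n=0}^\infty\frac{(\alpha-\gamma)_n(\alpha+\beta+k+n+1)_k}{(\gamma+\beta+2k+2)_n\,\Gamma(\alpha+k+n+1)}\frac{\rho^n}{n!}$ with $1/\Gamma$ entire. *)

(* Defs.v *)
From mathcomp Require Import all_boot all_order all_algebra complex.
From mathcomp Require Import all_classical all_reals all_analysis.

Set Implicit Arguments.
Unset Strict Implicit.
Unset Printing Implicit Defensive.

Import Order.TTheory GRing.Theory Num.Theory numFieldNormedType.Exports.

Local Open Scope classical_set_scope.
Local Open Scope complex_scope.
Local Open Scope ring_scope.

(* R[i] packed as a numClosedFieldType: the topology of a numeric field is
   inferred for such a packed type, but not for the bare type R[i]. *)
Definition Cplx (R : realType) : numClosedFieldType := R[i].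

Definition ofR (R : realType) (a : R) : Cplx R := a%:C.

Section ElementaryFunctions.
Variable R : realType.
Local Notation C := (Cplx R).

Definition cexp (z : C) : C :=
  ofR (expR (complex.Re z)) *
  (cos (complex.Im z) +i* sin (complex.Im z) : C).

(* Principal argument, in ]-pi, pi]. *)
Definition carg (z : C) : R :=
  let t := acos (complex.Re z / complex.Re `|z|) in
  if 0 <= complex.Im z then t else - t.

Definition clog (z : C) : C := (ln (complex.Re `|z|) +i* carg z).

(* Principal power. *)
Definition cpow (z s : C) : C :=
  if z == 0 then (s == 0)%:R else cexp (s * clog z).

(* Principal square root; unlike [sqrtC], whose values have a nonnegative
   imaginary part, [sqrtc] takes values of nonnegative real part. *)
Definition csqrt (z : C) : C := sqrtc z.

Definition csum (u : nat -> C) : C := limn (series u).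

End ElementaryFunctions.

Section SpecialFunctions.
Variable R : realType.
Local Notation C := (Cplx R).

Definition nonposint (z : C) : Prop := exists n : nat, z = - n%:R.

Definition poch (z : C) (n : nat) : C := \prod_(i < n) (z + i%:R).

(* The entire function 1 / Gamma, from Euler's limit
   Gamma z = lim n! n^z / (z (z + 1) ... (z + n)). *)
Definition rgamma (z : C) : C :=
  limn (fun n : nat => poch z n.+1 / (n`!%:R * cpow n%:R z) : C).

(* Takes the value 0 at the poles. *)
Definition cgamma (z : C) : C := (rgamma z)^-1.

Definition hyper_term (a b : seq C) (z : C) (n : nat) : C :=
  (\prod_(c <- a) poch c n) / (\prod_(c <- b) poch c n) * (z ^+ n / n`!%:R).

(* The generalized hypergeometric function pFq, p = size a and q = size b. *)
Definition hyper (a b : seq C) (z : C) : C := csum (hyper_term a b z).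

Definition jacobi (n : nat) (a b z : C) : C :=
  poch (a + 1) n / n`!%:R *
  hyper [:: - n%:R; n%:R + a + b + 1] [:: a + 1] ((1 - z) / 2).

Definition besselJ (nu z : C) : C :=
  if `[< nonposint (nu + 1) >] then
    csum (fun n : nat => (-1) ^+ n * cpow (z / 2) (2 * n%:R + nu)
                           / n`!%:R * rgamma (nu + n%:R + 1))
  else cpow (z / 2) nu / cgamma (nu + 1)
         * hyper [::] [:: nu + 1] (- (z ^+ 2 / 4)).

Definition besselI (nu z : C) : C :=
  if `[< nonposint (nu + 1) >] then
    csum (fun n : nat => cpow (z / 2) (2 * n%:R + nu)
                           / n`!%:R * rgamma (nu + n%:R + 1))
  else cpow (z / 2) nu / cgamma (nu + 1)
         * hyper [::] [:: nu + 1] (z ^+ 2 / 4).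

(* (2 / w)^s is encoded as (w / 2)^(- s). *)
Definition bessel_product (alpha beta x rho : C) : C :=
  cpow ((1 - x) * rho / 2) (- (alpha / 2)) *
  cpow ((1 + x) * rho / 2) (- (beta / 2)) *
  besselJ alpha (csqrt (2 * (1 - x) * rho)) *
  besselI beta (csqrt (2 * (1 + x) * rho)).

(* The function f, extended to 0 by continuity, takes the value v at z. *)
Definition has_value_ext0 (f : C -> C) (z v : C) : Prop :=
  if z == 0 then f r @[r --> (0 : C)^'] --> v else f z = v.

(* The factor of the k-th summand that may be singular in alpha, together with
   1 / Gamma (alpha + 1); the first branch is its analytic continuation in
   alpha to the parameters where the defining expression is undefined. *)
Definition hyper_factor (alpha beta gamma rho : C) (k : nat) : C :=
  if `[< nonposint (alpha + 1) \/ nonposint (alpha + beta + 1) >] then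
    4 ^- k * csum (fun n : nat =>
      poch (alpha - gamma) n * poch (alpha + beta + k%:R + n%:R + 1) k
        / poch (gamma + beta + 2 * k%:R + 2) n
        * rgamma (alpha + k%:R + n%:R + 1) * (rho ^+ n / n`!%:R))
  else
    poch ((alpha + beta + 1) / 2) k * poch ((alpha + beta + 2) / 2) k
      / (cgamma (alpha + 1) * poch (alpha + 1) k * poch (alpha + beta + 1) k)
      * hyper [:: 2 * k%:R + alpha + beta + 1; alpha - gamma]
              [:: alpha + beta + k%:R + 1; gamma + beta + 2 * k%:R + 2;
                  alpha + k%:R + 1] rho.

Definition expansion_term (alpha beta gamma x rho : C) (k : nat) : C :=
  (2 * k%:R + gamma + beta + 1) * poch (gamma + beta + 1) k
    / (poch (beta + 1) k * poch ((gamma + beta + 2) / 2) k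
         * poch ((gamma + beta + 3) / 2) k)
    * hyper_factor alpha beta gamma rho k
    * rho ^+ k * jacobi k gamma beta x.

End SpecialFunctions.

(* Main.v *)
Require Import Defs.
From mathcomp Require Import all_boot all_order all_algebra complex.
From mathcomp Require Import all_classical all_reals all_analysis.
From mathcomp Require Import ring lra zify.
Import Order.TTheory GRing.Theory Num.Theory numFieldNormedType.Exports.
Local Open Scope classical_set_scope.
Local Open Scope ring_scope.

Set Implicit Arguments.
Unset Strict Implicit.
Unset Printing Implicit Defensive.

(** Put y = (1 - x) / 2, w = (1 + x) / 2, s = gamma + beta + 1 and
    c_n = 1 / Gamma (alpha + 1 + n).

    For rho != 0 the powers in front of the Bessel functions cancel the powers in
    their definitions ([cpow_csqrt_cancel]), and the left-hand side is the
    product of the entire series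
      sum_m c_m (- y rho)^m / m!   and
      1 / Gamma (beta + 1) sum_n (w rho)^n / ((beta + 1)_n n!);
    by continuity it is so at rho = 0 too ([bessel_product_value0]). From
    c_m = (alpha + 1 + m)_(N-m) c_N, the coefficient of rho^N in the product of
    the two sums is c_N / (beta + 1)_N times the Jacobi polynomial
    P_N^(alpha,beta)(x), written symmetrically in y and w ([jacobi_form]).

    The right-hand side is a double series over k and n, and collecting rho^N,
    N = k + n, leaves c_N times a combination of the P_k^(gamma,beta)(x), k <= N.
    That both coefficients agree is the connection formula between the Jacobi
    polynomials of parameters (alpha, beta) and (gamma, beta)
    ([jacobi_connection]). As beta is common to both families, expanding in
    powers of w reduces it to a finite sum in two parameters, which satisfies a
    one-step recurrence ([connection_coeff]).

    Collecting powers of rho is legitimate because the (k, n) term is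
    at most 1 / (k + n)! up to a factor that grows exponentially
    ([double_term_bounded]): the factorial comes from c_(k+n), and every other
    factor is a quotient of Pochhammer symbols and factorials of equal lengths,
    a power, or a Jacobi polynomial. Under such a bound, sums by rows and by
    diagonals agree ([iterated_csum]); the same fact gives the Cauchy product on
    the left ([csum_cauchy_product]).

    The only property of Gamma involved is c_n = (alpha + 1 + n) c_(n+1). If
    alpha + 1 is not a nonpositive integer one may take
    c_n = 1 / (Gamma (alpha + 1) (alpha + 1)_n), for which it is immediate. The
    values 1 / Gamma (alpha + 1 + n) themselves occur only when alpha + 1 or
    alpha + beta + 1 is a nonpositive integer; alpha is then real, and on the
    real line Euler's limit exists by monotonicity ([rgamma_real_recurrence]). *)

(** * Pochhammer symbols and the connection formula for Jacobi polynomials *)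

Section Pochhammer.
Variable R : realType.
Local Notation C := (Cplx R).
Implicit Types (a b s z w y : C) (i j k l m n M N : nat).

Lemma poch0 z : poch z 0 = 1.
Proof. by rewrite /poch big_ord0. Qed.

Lemma pochS z n : poch z n.+1 = poch z n * (z + n%:R).
Proof. by rewrite /poch big_ord_recr. Qed.

Lemma pochD z m n : poch z (m + n) = poch z m * poch (z + m%:R) n.
Proof.
elim: n => [|n IH]; first by rewrite addn0 poch0 mulr1.
by rewrite addnS !pochS IH natrD addrA mulrA.
Qed.

Lemma pochSl z n : poch z n.+1 = z * poch (z + 1) n.
Proof. by rewrite -add1n pochD pochS poch0 mul1r addr0. Qed.

Lemma poch_double z n :
  poch (z / 2) n * poch ((z + 1) / 2) n = poch z (n + n) / 4 ^+ n.
Proof.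
elim: n => [|n IH]; first by rewrite !poch0 expr0 divr1 mulr1.
rewrite addSn addnS !pochS exprS natrD.
transitivity ((poch (z / 2) n * poch ((z + 1) / 2) n) *
   ((z / 2 + n%:R) * ((z + 1) / 2 + n%:R))); first by ring.
have h4 : (4 : C) ^+ n != 0 by rewrite expf_neq0 // pnatr_eq0.
rewrite IH -[(n + n).+1%:R]natr1 natrD; field.
by rewrite h4.
Qed.

Lemma poch_neq0 z n : (forall i, (i < n)%N -> z + i%:R != 0) -> poch z n != 0.
Proof.
by move=> h; apply/prodf_neq0 => i _; apply: h.
Qed.

(** Chu-Vandermonde: a + 1 - p and b + 1 + p make the two Pochhammer symbols
    falling factorials of a and of b + i, of lengths p and i - p. *)
Lemma poch_vandermonde a b i :
  \sum_(0 <= p < i.+1) 'C(i, p)%:R * poch (a + 1 - p%:R) p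
      * poch (b + 1 + p%:R) (i - p) = poch (a + b + 1) i.
Proof.
elim: i a b => [|i IH] a b.
  by rewrite big_nat1 subn0 !poch0 bin0 !mul1r.
rewrite pochS.
have -> : poch (a + b + 1) i * (a + b + 1 + i%:R) =
  (b + 1 + i%:R) * poch (a + b + 1) i + a * poch (a - 1 + (b + 1) + 1) i.
  have -> : a - 1 + (b + 1) + 1 = a + b + 1 by ring.
  ring.
rewrite -!IH !mulr_sumr big_nat_recl // bin0 subn0 poch0 !mul1r.
under eq_bigr => p _ do rewrite binS natrD subSS !mulrDl.
rewrite big_split /= addrA; congr (_ + _).
  rewrite [RHS]big_nat_recl // bin0 subn0 poch0 !mul1r pochS mulr0n addr0.
  rewrite mulrC; congr (_ + _).
  rewrite big_nat_recr //= bin_small // !mul0r addr0.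
  rewrite !big_nat; apply: eq_bigr => p /andP[_ hp].
  have -> : (i - p = (i - p.+1).+1)%N by lia.
  rewrite [poch _ (i - p.+1).+1]pochS.
  have -> : b + 1 + p.+1%:R + (i - p.+1)%:R = b + 1 + i%:R.
    by rewrite natrB //; ring.
  ring.
apply: eq_bigr => p _.
have -> : b + 1 + p.+1%:R = b + 1 + 1 + p%:R by rewrite -natr1; ring.
rewrite pochS.
have -> : a + 1 - p.+1%:R = a - p%:R by rewrite -natr1; ring.
have -> : a - 1 + 1 - p%:R = a - p%:R by ring.
ring.
Qed.

Lemma sum_triangle (F : nat -> nat -> C) N :
  \sum_(0 <= i < N.+1) \sum_(0 <= p < i.+1) F i p
  = \sum_(0 <= p < N.+1) \sum_(0 <= l < (N - p).+1) F (p + l)%N p.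
Proof.
elim: N => [|N IH]; first by rewrite !big_nat1.
rewrite big_nat_recr //= IH [RHS]big_nat_recr //= subnn big_nat1 addn0.
rewrite [\sum_(0 <= p < N.+2) F N.+1 p]big_nat_recr //= addrA; congr (_ + _).
rewrite -big_split /= !big_nat; apply: eq_bigr => p /andP[_ hp].
rewrite subSn // [RHS]big_nat_recr //=; congr (_ + F _ _); lia.
Qed.

(** The symmetric form of the Jacobi polynomial P_n^(a,b)(z), for
    y = (1 - z) / 2 and w = (1 + z) / 2; each quotient of a Pochhammer symbol
    by a factorial is a generalized binomial coefficient, C(n + a, n - m) or
    C(n + b, m). *)
Definition jacobi_form n a b y w : C :=
  \sum_(0 <= m < n.+1) (- y) ^+ m * w ^+ (n - m)
     * poch (a + 1 + m%:R) (n - m) * poch (b + 1 + (n - m)%:R) m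
     / (m`!%:R * (n - m)`!%:R).

Lemma jacobi_form_sym n a b y w :
  jacobi_form n a b y w = (-1) ^+ n * jacobi_form n b a w y.
Proof.
rewrite /jacobi_form big_nat_rev /= mulr_sumr !big_nat.
apply: eq_bigr => m /andP[_ hm].
rewrite add0n subSS.
have -> : (n - (n - m) = m)%N by lia.
rewrite [(- y) ^+ _]exprNn [(- w) ^+ _]exprNn.
have -> : (-1) ^+ n = (-1) ^+ (n - m) * (-1) ^+ m :> C.
  by rewrite -exprD subnK.
have h : (-1) ^+ m * (-1) ^+ m = 1 :> C by rewrite -expr2 sqrr_sign.
rewrite [m`!%:R * _]mulrC.
rewrite -[LHS]mulr1 -[X in _ * X = _]h; ring.
Qed.

Lemma fact_neq0 n : n`!%:R != 0 :> C.
Proof. by rewrite pnatr_eq0 -lt0n fact_gt0. Qed.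

Lemma bin_factE n m : (m <= n)%N ->
  'C(n, m)%:R = n`!%:R / (m`!%:R * (n - m)`!%:R) :> C.
Proof.
move=> h; rewrite -(bin_fact h) !natrM mulfK // mulf_neq0 ?fact_neq0.
Qed.

(** Expanding (1 - w)^(n - p) gives the coefficient of w^i as a sum over p that
    [poch_vandermonde] evaluates. With the symmetry above this yields the
    expansion at either end of [-1, 1]. *)
Lemma jacobi_form_power n a b w :
  jacobi_form n a b (1 - w) w =
  \sum_(0 <= i < n.+1) (-1) ^+ (n - i) * poch (n%:R + a + b + 1) i
     * poch (b + 1 + i%:R) (n - i) / (i`!%:R * (n - i)`!%:R) * w ^+ i.
Proof.
rewrite jacobi_form_sym mulr_sumr.
transitivity (\sum_(0 <= i < n.+1) \sum_(0 <= p < i.+1)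
  (-1) ^+ (n - i) * ('C(i, p)%:R * poch (n%:R + a + 1 - p%:R) p
      * poch (b + 1 + p%:R) (i - p))
     * poch (b + 1 + i%:R) (n - i) / (i`!%:R * (n - i)`!%:R) * w ^+ i);
  last first.
  apply: eq_bigr => i _.
  by rewrite -poch_vandermonde mulr_sumr !mulr_suml.
rewrite sum_triangle !big_nat; apply: eq_bigr => p /andP[_ hp].
transitivity ((-1) ^+ n * ((- 1) ^+ p * w ^+ p * (1 - w) ^+ (n - p)
  * poch (b + 1 + p%:R) (n - p) * poch (a + 1 + (n - p)%:R) p
     / (p`!%:R * (n - p)`!%:R))); first by rewrite [(- w) ^+ p]exprNn.
rewrite exprBn.
transitivity ((\sum_(i < (n - p).+1)
            (-1) ^+ i * 1 ^+ (n - p - i) * w ^+ i *+ 'C(n - p, i)) *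
   ((-1) ^+ n * ((- 1) ^+ p * w ^+ p
  * poch (b + 1 + p%:R) (n - p) * poch (a + 1 + (n - p)%:R) p
     / (p`!%:R * (n - p)`!%:R)))); first by ring.
rewrite mulr_suml -(big_mkord xpredT (fun i => ((-1) ^+ i * 1 ^+ (n - p - i)
   * w ^+ i *+ 'C(n - p, i)) * ((-1) ^+ n * ((- 1) ^+ p * w ^+ p
  * poch (b + 1 + p%:R) (n - p) * poch (a + 1 + (n - p)%:R) p
     / (p`!%:R * (n - p)`!%:R))))) !big_nat.
apply: eq_bigr => l /andP[_ hl].
rewrite expr1n mulr1 -mulr_natr.
have -> : (p + l - p = l)%N by lia.
have -> : (n - p = l + (n - (p + l)))%N by lia.
set q := (n - (p + l))%N.
have en : n = (q + p + l)%N by lia.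
rewrite pochD !natrD.
have -> : b + 1 + p%:R + l%:R = b + 1 + (p%:R + l%:R) by ring.
have -> : n%:R + a + 1 - p%:R = a + 1 + (l%:R + q%:R) by rewrite en !natrD; ring.
rewrite !bin_factE; try lia.
have -> : (l + q - l = q)%N by lia.
have -> : (p + l - p = l)%N by lia.
have -> : (-1) ^+ n = (-1) ^+ q * (-1) ^+ p * (-1) ^+ l :> C.
  by rewrite en !exprD.
have h t : (-1) ^+ t * (-1) ^+ t = 1 :> C by rewrite -expr2 sqrr_sign.
transitivity (((-1) ^+ p * (-1) ^+ p) * ((-1) ^+ l * (-1) ^+ l) *
  ((-1) ^+ q * poch (b + 1 + p%:R) l *
 poch (b + 1 + (p%:R + l%:R)) q * poch (a + 1 + (l%:R + q%:R)) p *
 w ^+ (p + l) / (p`!%:R * l`!%:R * q`!%:R))).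
  rewrite exprD; field.
  by rewrite ?natrD !fact_neq0.
rewrite !h; field.
by rewrite !fact_neq0.
Qed.

(** Call the sum f_M(a, s). Splitting s + 2j turns each summand into two
    fractions with denominators (s + j)_M and (s + j + 1)_M; the two numerators
    over a common denominator (s + j + 1)_M add up to a multiple of s + 1 + 2j,
    and f_M(a, s) = - f_(M-1)(a + 1, s + 1). *)
Lemma connection_coeff M a s :
  (forall i, s + i%:R != 0) ->
  \sum_(0 <= j < M.+1) (-1) ^+ j * 'C(M, j)%:R * poch (a - s) (M - j)
     * poch (a + M%:R) j * (s + (2 * j)%:R) / poch (s + j%:R) M.+1
  = (-1) ^+ M.
Proof.
elim: M a s => [|M IH] a s hs.
  have s0 : s != 0 by have := hs 0%N; rewrite addr0.
  by rewrite big_nat1 subn0 !poch0 pochS poch0 bin0 muln0 mulr0n !addr0 !mul1r divff.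
pose T j : C := (-1) ^+ j * poch (a - s) (M.+1 - j) * poch (a + M.+1%:R) j.
have hp j n : poch (s + j%:R) n != 0.
  by apply: poch_neq0 => i _; rewrite -addrA -natrD.
(* Multiply M' (s + 2j) = j (s + j + M') + (M' - j) (s + j) by 'C(M', j) / M',
   where M' = M + 1. *)
have split1 j : (j <= M.+1)%N ->
  (-1) ^+ j * 'C(M.+1, j)%:R * poch (a - s) (M.+1 - j)
     * poch (a + M.+1%:R) j * (s + (2 * j)%:R) / poch (s + j%:R) M.+2
  = T j * (if j is j'.+1 then 'C(M, j')%:R else 0) / poch (s + j%:R) M.+1
  + T j * 'C(M, j)%:R / poch (s + j.+1%:R) M.+1.
  move=> hj.
  have e1 : poch (s + j%:R) M.+2 = poch (s + j%:R) M.+1 * (s + j%:R + M.+1%:R).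
    by rewrite pochS.
  have e2 : poch (s + j%:R) M.+2 = (s + j%:R) * poch (s + j.+1%:R) M.+1.
    by rewrite pochSl -addrA -natr1.
  have u1 : poch (s + j%:R) M.+1 != 0 by [].
  have u2 : poch (s + j.+1%:R) M.+1 != 0 by [].
  have v1 : s + j%:R + M.+1%:R != 0 by rewrite -addrA -natrD.
  have v2 : s + j%:R != 0 by [].
  have -> : (poch (s + j%:R) M.+1)^-1 = (s + j%:R + M.+1%:R) / poch (s + j%:R) M.+2.
    by rewrite e1 invfM mulrCA divff // mulr1.
  have -> : (poch (s + j.+1%:R) M.+1)^-1 = (s + j%:R) / poch (s + j%:R) M.+2.
    by rewrite e2 invfM mulrA divff // mul1r.
  have key : 'C(M.+1, j)%:R * (s + (2 * j)%:R) =
     (if j is j'.+1 then 'C(M, j')%:R else 0) * (s + j%:R + M.+1%:R)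
      + 'C(M, j)%:R * (s + j%:R) :> C.
    case: j hj {e1 e2 u1 u2 v1 v2} => [|j] hj.
      by rewrite !bin0 muln0 mulr0n !addr0 mul0r add0r.
    have hb : 'C(M, j)%:R * (M%:R - j%:R) = 'C(M, j.+1)%:R * j.+1%:R :> C.
      rewrite -natrB // -!natrM; congr (_%:R).
      by have := mul_bin_left M j; lia.
    rewrite binS natrD mulnC natrM -[j.+1%:R]natr1 -[M.+1%:R]natr1.
    rewrite -[j.+1%:R]natr1 in hb.
    have -> : ('C(M, j.+1)%:R + 'C(M, j)%:R) * (s + (j%:R + 1) * 2) =
      'C(M, j.+1)%:R * (s + (j%:R + 1)) + 'C(M, j)%:R * (s + (j%:R + 1) * 2)
      + 'C(M, j.+1)%:R * (j%:R + 1) :> C by ring.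
    rewrite -hb; move: ('C(M, j)%:R) ('C(M, j.+1)%:R) => u v; ring.
  rewrite /T.
  transitivity ((-1) ^+ j * poch (a - s) (M.+1 - j) * poch (a + M.+1%:R) j
    / poch (s + j%:R) M.+2 * ('C(M.+1, j)%:R * (s + (2 * j)%:R))); first by ring.
  rewrite key; ring.
transitivity (\sum_(0 <= j < M.+2)
   (T j * (if j is j'.+1 then 'C(M, j')%:R else 0) / poch (s + j%:R) M.+1
  + T j * 'C(M, j)%:R / poch (s + j.+1%:R) M.+1)).
  by rewrite !big_nat; apply: eq_bigr => j /andP[_ hj]; rewrite split1.
rewrite big_split /= big_nat_recl //= mulr0 mul0r add0r.
rewrite [X in _ + X]big_nat_recr //= bin_small // mulr0 mul0r addr0.
rewrite -big_split /= exprS mulN1r -(IH (a + 1) (s + 1)); last first.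
  by move=> i; rewrite -addrA nat1r.
rewrite -sumrN !big_nat; apply: eq_bigr => j /andP[_ hj].
rewrite /T subSS.
have -> : (M.+1 - j = (M - j).+1)%N by lia.
rewrite [poch (a - s) _.+1]pochS [poch (a + _) j.+1]pochS.
have -> : a + 1 - (s + 1) = a - s by ring.
have -> : a + 1 + M%:R = a + M.+1%:R by rewrite -natr1; ring.
have -> : s + 1 + (2 * j)%:R = s + 1 + j%:R + j%:R by rewrite mulnC natrM; ring.
have -> : s + 1 + j%:R = s + j.+1%:R by rewrite -natr1; ring.
rewrite natrB // exprS.
move: (poch _ _) (poch _ _) (poch _ _)^-1 => p1 p2 p3; rewrite -natr1.
ring.
Qed.

(** Once divided by (b + 1)_n, the polynomials P_n^(a,b) and P_n^(g,b) have
    expansions in powers of w that carry the same factor 1 / (b + 1)_i, so that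
    comparing the coefficients of w^i involves only a + b + 1 and g + b + 1: they
    agree by [connection_coeff] for M = N - i, at these two numbers plus 2i. *)
Lemma jacobi_connection N a b g w :
  (forall i, g + b + 1 + i%:R != 0) -> (forall i, b + 1 + i%:R != 0) ->
  jacobi_form N a b (1 - w) w / poch (b + 1) N =
  \sum_(0 <= k < N.+1)
    poch (a - g) (N - k) * poch (a + b + 1 + N%:R) k
    / (poch (g + b + 1 + k%:R) k * poch (g + b + 1 + (2 * k).+1%:R) (N - k)
       * (N - k)`!%:R)
    * (jacobi_form k g b (1 - w) w / poch (b + 1) k).
Proof.
set s := g + b + 1; set A := a + b + 1 => hs hb.
have hsp j n : poch (s + j%:R) n != 0.
  by apply: poch_neq0 => i _; rewrite -addrA -natrD.
have hbp n : poch (b + 1) n != 0 by apply: poch_neq0.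
have Sb n a' : jacobi_form n a' b (1 - w) w / poch (b + 1) n =
   \sum_(0 <= i < n.+1) (-1) ^+ (n - i) * poch (a' + b + 1 + n%:R) i
      / (poch (b + 1) i * i`!%:R * (n - i)`!%:R) * w ^+ i.
  rewrite jacobi_form_power mulr_suml !big_nat; apply: eq_bigr => i /andP[_ hi].
  have e : poch (b + 1) n = poch (b + 1) i * poch (b + 1 + i%:R) (n - i).
    by rewrite -pochD subnKC.
  have -> : n%:R + a' + b + 1 = a' + b + 1 + n%:R by ring.
  have := hbp n; rewrite e mulf_eq0 negb_or => /andP[h1 h2].
  by field; rewrite !fact_neq0 h1 h2.
rewrite Sb.
under [RHS]eq_bigr => k _ do rewrite Sb mulr_sumr.
rewrite sum_triangle !big_nat; apply: eq_bigr => i /andP[_ hi].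
pose M := (N - i)%N.
have eN : N%:R = M%:R + i%:R :> C by rewrite -natrD subnK.
have hs' j : s + (2 * i)%:R + j%:R != 0 by rewrite -addrA -natrD.
have := @connection_coeff M (A + (2 * i)%:R) (s + (2 * i)%:R) hs'.
rewrite -/M => <-.
rewrite !mulr_suml !big_nat; apply: eq_bigr => j /andP[_ hj].
have -> : (N - (i + j) = M - j)%N by rewrite /M; lia.
have -> : (i + j - i = j)%N by lia.
rewrite bin_factE //.
have -> : A + (2 * i)%:R - (s + (2 * i)%:R) = a - g by rewrite /A /s; ring.
rewrite pochD.
have -> : A + N%:R + i%:R = A + (2 * i)%:R + M%:R by rewrite eN mulnC natrM; ring.
rewrite -/s.
(* For k = i + j:
   (s + k)_i (s + k + i)_(M+1) = (s + k)_k (s + 2k) (s + 2k + 1)_(N-k). *)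
have e1 : poch (s + (i + j)%:R) i * poch (s + (2 * i)%:R + j%:R) M.+1
   = poch (s + (i + j)%:R) (i + j) * (s + (2 * i)%:R + (2 * j)%:R)
     * poch (s + (2 * (i + j)).+1%:R) (M - j).
  have -> : s + (2 * i)%:R + j%:R = s + (i + j)%:R + i%:R.
    by rewrite natrD mulnC natrM; ring.
  rewrite -pochD.
  have -> : (i + M.+1 = i + j + 1 + (M - j))%N by lia.
  rewrite pochD [poch _ (i + j + 1)]pochD [poch _ 1]pochS poch0 mul1r.
  congr (_ * _ * poch _ _).
  - by rewrite ![(2 * _)%:R]natrM ![(i + j)%:R]natrD; ring.
  - by rewrite -natr1 natrM [(i + j)%:R]natrD [(i + j + 1)%:R]natrD [(i + j)%:R]natrD; ring.
have u0 : s + (2 * i)%:R + (2 * j)%:R != 0 by rewrite -addrA -natrD.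
have u1 := hsp (i + j)%N i.
have u2 : poch (s + (2 * i)%:R + j%:R) M.+1 != 0 by rewrite -addrA -natrD.
have u3 := hsp (i + j)%N (i + j)%N.
have u4 := hsp (2 * (i + j)).+1 (M - j)%N.
set P := poch (a - g) _; set Q1 := poch (A + _) _; set Q2 := poch (_ + M%:R) j.
have e2 : (s + (2 * i)%:R + (2 * j)%:R) / poch (s + (2 * i)%:R + j%:R) M.+1
   = poch (s + (i + j)%:R) i / (poch (s + (i + j)%:R) (i + j) *
     poch (s + (2 * (i + j)).+1%:R) (M - j)).
  apply/eqP; rewrite eqr_div ?mulf_neq0 //; apply/eqP.
  by rewrite [RHS]e1; ring.
have -> : s + (2 * i)%:R + (2 * j)%:R = (s + (2 * i)%:R + (2 * j)%:R) /
  poch (s + (2 * i)%:R + j%:R) M.+1 * poch (s + (2 * i)%:R + j%:R) M.+1.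
  by rewrite divfK.
rewrite e2; field.
by rewrite !fact_neq0 hbp u2 u3 u4.
Qed.
End Pochhammer.

(** * Series of complex numbers *)

Section ComplexSequences.
Variable R : realType.
Local Notation C := (Cplx R).

Lemma ofR_inj : injective (@ofR R).
Proof. by move=> a b []. Qed.

Lemma ofRD (a b : R) : ofR (a + b) = ofR a + ofR b.
Proof. exact: (rmorphD (real_complex R)). Qed.

Lemma ofRM (a b : R) : ofR (a * b) = ofR a * ofR b.
Proof. exact: (rmorphM (real_complex R)). Qed.

Lemma ofRN (a : R) : ofR (- a) = - ofR a.
Proof. exact: (rmorphN (real_complex R)). Qed.

Lemma ofRV (a : R) : ofR a^-1 = (ofR a)^-1.
Proof. exact: (fmorphV (real_complex R)). Qed.

Lemma ofRX (a : R) n : ofR (a ^+ n) = ofR a ^+ n.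
Proof. exact: (rmorphXn (real_complex R)). Qed.

Lemma ofR_nat n : ofR (n%:R : R) = n%:R.
Proof. exact: (rmorph_nat (real_complex R)). Qed.

Lemma ofR0 : ofR (0 : R) = 0.
Proof. by []. Qed.

Lemma ofR1 : ofR (1 : R) = 1.
Proof. by []. Qed.

Lemma ofR_eq0 (a : R) : (ofR a == 0) = (a == 0).
Proof. exact: (fmorph_eq0 (real_complex R)). Qed.

Lemma ofR_le (a b : R) : (ofR a <= ofR b) = (a <= b).
Proof. exact: lecR. Qed.

Lemma ofR_lt (a b : R) : (ofR a < ofR b) = (a < b).
Proof. exact: ltcR. Qed.

Lemma norm_ofR (a : R) : `|ofR a| = ofR `|a|.
Proof. by rewrite /ofR normc_def /= expr0n addr0 sqrtr_sqr. Qed.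

Lemma ofR_Re (z : C) : z \is Num.real -> ofR (complex.Re z) = z.
Proof. exact: RRe_real. Qed.

(** The norm of [Cplx R] is complex-valued; this is its real value. *)
Definition modulus (z : C) : R := complex.Re `|z|.

Lemma modulusE (z : C) : `|z| = ofR (modulus z).
Proof. by rewrite /modulus ofR_Re // normr_real. Qed.

Lemma Cplx_pos_real (e : C) : 0 < e -> exists2 d : R, 0 < d & e = ofR d.
Proof.
move=> e0; have ee : ofR (complex.Re e) = e by rewrite ofR_Re // gtr0_real.
by exists (complex.Re e) => //; rewrite -ofR_lt ee.
Qed.

Lemma cvg_dominated (u : nat -> C) (l : C) (e : nat -> R) :
  (forall n, `|l - u n| <= ofR (e n)) -> e n @[n --> \oo] --> (0 : R) ->
  u n @[n --> \oo] --> l.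
Proof.
move=> h he; apply/cvgrPdist_lt => eps /Cplx_pos_real[d d0 ->].
move/cvgrPdist_lt : he => /(_ _ d0); apply: filterS => n.
rewrite sub0r normrN => hn; apply: (le_lt_trans (h n)).
by rewrite ofR_lt (le_lt_trans _ hn) // ler_norm.
Qed.

Lemma cvg_ofR (u : nat -> R) (l : R) :
  u n @[n --> \oo] --> l -> ofR (u n) @[n --> \oo] --> ofR l.
Proof.
move=> /cvgrPdist_lt h; apply/cvgrPdist_lt => eps /Cplx_pos_real[d d0 ->].
move: (h _ d0); apply: filterS => n hn.
by rewrite -ofRN -ofRD norm_ofR ofR_lt.
Qed.

Lemma cvg_Cplx (u : nat -> C) :
  cvgn (@complex.Re R \o u) -> cvgn (@complex.Im R \o u) -> cvgn u.
Proof.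
move=> /cvg_ofR h1 /cvg_ofR h2.
suff -> : u = (fun n => ofR (complex.Re (u n)) + 'i%C * ofR (complex.Im (u n))).
  apply/cvg_ex; eexists; apply: cvgD; first exact: h1.
  by apply: cvgM; [exact: cvg_cst | exact: h2].
by apply/funext => n; exact: complexE.
Qed.

Lemma limn_unique (u : nat -> C) (l : C) : u n @[n --> \oo] --> l -> limn u = l.
Proof. by apply: cvg_lim; exact: norm_hausdorff. Qed.

(** A fixed ratio suffices, as the series to be bounded have terms that decrease
    factorially. *)
Definition geometrically_bounded (M : R) (u : nat -> C) :=
  forall n, `|u n| <= ofR (geometric M 2^-1 n).

Lemma half_lt1 : `|2^-1 : R| < 1.
Proof. by rewrite ger0_norm ?invr_ge0 // invf_lt1 // ltr1n. Qed.

(** The real and imaginary parts converge absolutely. *)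
Lemma cvg_series_bounded (M : R) (u : nat -> C) :
  geometrically_bounded M u -> cvgn (series u).
Proof.
move=> hu.
have cvgR (v : nat -> R) : (forall n, `|v n| <= geometric M 2^-1 n) ->
    cvgn (series v).
  move=> hv; apply: normed_cvg.
  apply: (series_le_cvg _ _ hv) => [n|n|]; first by [].
    exact: le_trans (hv n).
  exact: is_cvg_geometric_series half_lt1.
apply: cvg_Cplx.
  suff -> : @complex.Re R \o series u = series (@complex.Re R \o u).
    apply: cvgR => n; rewrite -ofR_le.
    exact: le_trans (normc_ge_Re _) (hu n).
  by apply/funext => n; rewrite /series /= (raddf_sum (@complex.Re R : Rcomplex R -> R)).
suff -> : @complex.Im R \o series u = series (@complex.Im R \o u).
  apply: cvgR => n; rewrite -ofR_le.
  apply: le_trans (hu n); rewrite -[leRHS]mul1r.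
  have -> : 1 = `|'i%C : C|.
    by rewrite normc_def /= expr0n expr1n add0r sqrtr1.
  rewrite mulrC -normrM; apply: le_trans (normc_ge_Re _).
  by rewrite ReiNIm normrN.
by apply/funext => n; rewrite /series /= (raddf_sum (@complex.Im R : Rcomplex R -> R)).
Qed.

Lemma series_tail_bounded (M : R) (u : nat -> C) n m :
  geometrically_bounded M u -> (n <= m)%N ->
  `|series u m - series u n| <= ofR (M * 2 * 2^-1 ^+ n).
Proof.
move=> hu hnm.
have M0 : 0 <= M.
  have := le_trans (normr_ge0 _) (hu 0%N).
  by rewrite /= expr0 mulr1 -ofR0 ofR_le.
apply: (@le_trans _ _ (ofR (M * 2 * (2^-1 ^+ n - 2^-1 ^+ m)))); last first.
  rewrite ofR_le ler_wpM2l ?mulr_ge0 // gerBl exprn_ge0 // invr_ge0 //.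
rewrite -(subnKC hnm); elim: (m - n)%N => [|k IH].
  by rewrite addn0 !subrr normr0 mulr0.
rewrite addnS seriesSr.
have -> : series u (n + k) + u (n + k)%N - series u n
  = (series u (n + k) - series u n) + u (n + k)%N by rewrite addrAC.
apply: (le_trans (ler_normD _ _)).
apply: (le_trans (lerD IH (hu _))).
rewrite -ofRD ofR_le /= exprS le_eqVlt; apply/orP; left; apply/eqP.
by field.
Qed.

Lemma csum_tail_bounded (M : R) (u : nat -> C) n :
  geometrically_bounded M u ->
  `|csum u - series u n| <= ofR (M * 2 * 2^-1 ^+ n).
Proof.
move=> hu; apply/ler_addgt0Pr => e e0.
have /cvgrPdist_lt/(_ _ e0) := cvg_series_bounded hu.
case=> N _ hN.
have := hN (maxn N n) (leq_maxl _ _); rewrite -/(csum u) => h.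
rewrite -(subrK (series u (maxn N n)) (csum u)) -addrA addrC.
apply: (le_trans (ler_normD _ _)); apply: lerD; last exact: ltW.
by apply: series_tail_bounded => //; exact: leq_maxr.
Qed.

Lemma cvg_csum (M : R) (u : nat -> C) :
  geometrically_bounded M u -> series u n @[n --> \oo] --> csum u.
Proof. exact: cvg_series_bounded. Qed.

Lemma csum_bounded (M : R) (u : nat -> C) :
  geometrically_bounded M u -> `|csum u| <= ofR (M * 2).
Proof.
move=> hu; have := csum_tail_bounded 0 hu.
by rewrite /series /= big_geq // subr0 expr0 mulr1.
Qed.

Lemma csum_finite (u : nat -> C) N :
  (forall n, (N <= n)%N -> u n = 0) -> csum u = \sum_(0 <= n < N) u n.
Proof.
move=> hu; apply: limn_unique.
apply: cvg_near_cst; exists N => // n /= hn.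
rewrite /series /= (@big_cat_nat _ _ _ N) //= [X in _ + X]big_nat_cond.
by rewrite [X in _ + X]big1 ?addr0 // => i; rewrite andbT => /andP[/hu].
Qed.

Lemma csumZ (M : R) (u : nat -> C) (a : C) :
  geometrically_bounded M u -> csum (fun n => a * u n) = a * csum u.
Proof.
move=> hu; apply: limn_unique.
have -> : series (fun n => a * u n) = (fun n => a * series u n).
  by apply/funext => n; rewrite /series /= mulr_sumr.
by apply: cvgM; [exact: cvg_cst | exact: cvg_csum hu].
Qed.

(** n 2^-n <= 2 (3/4)^n, because n <= 2 (3/2)^n. *)
Lemma cvg_linear_geometric (M : R) : geometric M 2^-1 n *+ n @[n --> \oo] --> (0 : R).
Proof.
have lin n : n%:R <= 2 * (3 / 2) ^+ n :> R.
  elim: n => [|n IH]; first by rewrite expr0 mulr1.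
  have : 1 <= (3 / 2) ^+ n :> R by rewrite exprn_ege1 // ler_pdivlMr // mul1r ler_nat.
  by rewrite exprS -[n.+1%:R]natr1; move: ((3 / 2) ^+ n) IH => X IH h1; lra.
have lt1 : `|3 / 4 : R| < 1 by rewrite ger0_norm; lra.
have hc := cvg_geometric (`|M| * 2) lt1.
apply: norm_cvg0; apply: squeeze_cvgr (cvg_cst 0) hc.
apply: nearW => n; rewrite normr_ge0 /= -[_ *+ n]mulr_natr !normrM.
have -> : `|2^-1 ^+ n : R| = 2^-1 ^+ n by rewrite ger0_norm.
rewrite normr_nat -!mulrA ler_wpM2l //.
have -> : (3 / 4 : R) = 2^-1 * (3 / 2) by field.
by rewrite exprMn mulrCA ler_wpM2l.
Qed.

(** Up to K, the rows and the diagonals differ by the tails of the rows k < K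
    beyond the index K - k; each is O(2^-K), and there are K of them. *)
Lemma double_series_diagonal (M : R) (a : nat -> nat -> C) :
  (forall k n, `|a k n| <= ofR (geometric M 2^-1 (k + n))) ->
  (series (fun k => csum (a k)) K - \sum_(0 <= N < K) \sum_(0 <= k < N.+1) a k (N - k)%N)
    @[K --> \oo] --> 0.
Proof.
move=> ha.
have ha' k : geometrically_bounded (geometric M 2^-1 k) (a k).
  by move=> n; rewrite /= -mulrA -exprD.
apply: (@cvg_dominated _ _ (fun K => geometric (M * 2) 2^-1 K *+ K)); last first.
  exact: cvg_linear_geometric.
move=> K; rewrite sub0r normrN.
have -> : \sum_(0 <= N < K) \sum_(0 <= k < N.+1) a k (N - k)%N =
  \sum_(0 <= k < K) series (a k) (K - k)%N.
  case: K => [|K]; first by rewrite !big_geq.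
  rewrite (sum_triangle (fun N k => a k (N - k)%N)) !big_nat.
  apply: eq_bigr => k /andP[_ hk]; rewrite subSn // /series /=.
  by apply: eq_bigr => l _; congr (a _ _); lia.
rewrite /series /= -sumrB.
apply: (le_trans (ler_norm_sum _ _ _)).
have -> : ofR (geometric (M * 2) 2^-1 K *+ K)
  = \sum_(0 <= i < K) ofR (geometric (M * 2) 2^-1 K) :> C.
  by rewrite sumr_const_nat subn0; exact: (raddfMn (real_complex R)).
rewrite !big_nat; apply: ler_sum => k /andP[_ hk].
apply: (le_trans (csum_tail_bounded _ (ha' k))).
rewrite /= ofR_le le_eqVlt; apply/orP; left; apply/eqP.
rewrite -[in RHS](subnKC (ltnW hk)) exprD; ring.
Qed.

End ComplexSequences.

Section SeriesProducts.
Variable R : realType.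
Local Notation C := (Cplx R).

Lemma iterated_csum (M : R) (a : nat -> nat -> C) (l : C) :
  (forall k n, `|a k n| <= ofR (geometric M 2^-1 (k + n))) ->
  (\sum_(0 <= N < K) \sum_(0 <= k < N.+1) a k (N - k)%N) @[K --> \oo] --> l ->
  series (fun k => csum (a k)) K @[K --> \oo] --> l.
Proof.
move=> ha hl; have := cvgD (FF := eventually_filter) (double_series_diagonal ha) hl.
rewrite add0r.
set f := (X in X @ _ --> _); suff -> : f = series (fun k => csum (a k)). by [].
by apply/funext => K; exact: subrK.
Qed.

Lemma csum_cauchy_product (M1 M2 : R) (u v : nat -> C) :
  geometrically_bounded M1 u -> geometrically_bounded M2 v ->
  (\sum_(0 <= N < K) \sum_(0 <= k < N.+1) u k * v (N - k)%N) @[K --> \oo]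
    --> csum u * csum v.
Proof.
move=> hu hv.
have ha k n : `|u k * v n| <= ofR (geometric (M1 * M2) 2^-1 (k + n)).
  rewrite normrM /= exprD mulrACA ofRM.
  by apply: ler_pM.
have h1 : series (fun k => csum (fun n => u k * v n)) K @[K --> \oo] --> csum u * csum v.
  have -> : series (fun k => csum (fun n => u k * v n)) =
    (fun K => series u K * csum v).
    apply/funext => K; rewrite /series /= mulr_suml.
    by apply: eq_bigr => k _; rewrite (csumZ _ hv).
  exact: cvgM (cvg_csum hu) (cvg_cst _).
have := cvgB (FF := eventually_filter) h1 (double_series_diagonal ha); rewrite subr0.
set f := (X in X @ _ --> _).
set D := (X in _ -> X @ _ --> _); suff -> : f = D by [].
by apply/funext => K; rewrite /f /= opprB addrC subrK.
Qed.
End SeriesProducts.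

(** * Exponential growth *)

Section ExponentialBounds.
Variable R : realType.
Local Notation C := (Cplx R).
Implicit Types (f g : nat -> nat -> C) (h : nat -> C) (z : C).

(** The exponent (k + n).+1, instead of k + n, absorbs constant factors. *)
Definition exp_bounded f :=
  exists2 E : C, 1 <= E & forall k n, `|f k n| <= E ^+ (k + n).+1.

Definition exp_bounded1 h :=
  exists2 E : C, 1 <= E & forall n, `|h n| <= E ^+ n.+1.

Lemma exp_boundedM f g :
  exp_bounded f -> exp_bounded g -> exp_bounded (fun k n => f k n * g k n).
Proof.
move=> [E hE hf] [F hF hg]; exists (E * F); first by rewrite mulr_ege1.
by move=> k n; rewrite normrM exprMn; apply: ler_pM.
Qed.

Lemma exp_bounded_le f g : (forall k n, `|f k n| <= `|g k n|) ->
  exp_bounded g -> exp_bounded f.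
Proof.
by move=> h [E hE hg]; exists E => // k n; apply: le_trans (h k n) (hg k n).
Qed.

Lemma exp_bounded1_le h1 h2 :
  (forall n, `|h1 n| <= `|h2 n|) -> exp_bounded1 h2 -> exp_bounded1 h1.
Proof. by move=> h [E hE hh]; exists E => // n; exact: le_trans (h n) (hh n). Qed.

Lemma exp_bounded1M h1 h2 :
  exp_bounded1 h1 -> exp_bounded1 h2 -> exp_bounded1 (fun n => h1 n * h2 n).
Proof.
move=> [E hE hf] [F hF hg]; exists (E * F); first by rewrite mulr_ege1.
by move=> n; rewrite normrM exprMn; apply: ler_pM.
Qed.

Lemma exp_bounded_sum h : exp_bounded1 h -> exp_bounded (fun k n => h (k + n)%N).
Proof. by move=> [E hE hh]; exists E. Qed.

Lemma exp_bounded_l h : exp_bounded1 h -> exp_bounded (fun k n => h k).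
Proof.
move=> [E hE hh]; exists E => // k n; apply: (le_trans (hh k)).
by rewrite ler_weXn2l // ltnS leq_addr.
Qed.

Lemma exp_bounded_r h : exp_bounded1 h -> exp_bounded (fun k n => h n).
Proof.
move=> [E hE hh]; exists E => // k n; apply: (le_trans (hh n)).
by rewrite ler_weXn2l // ltnS leq_addl.
Qed.

(** E^(n+1) / n! = E 2^-n (2E)^n / n! and (2E)^n / n! <= exp (2E). *)
Lemma exp_bounded1_fact h :
  exp_bounded1 h -> exists M : R, geometrically_bounded M (fun n => h n / n`!%:R).
Proof.
move=> [E hE hh].
have [e e0 eE] := Cplx_pos_real (lt_le_trans ltr01 hE).
exists (e * expR (2 * e)) => n /=.
rewrite normrM normfV normr_nat.
apply: (le_trans (ler_wpM2r _ (hh n))); first by rewrite invr_ge0 ler0n.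
rewrite eE -ofRX -ofR_nat -ofRV -ofRM ofR_le exprS -!mulrA ler_pM2l //.
have -> : e ^+ n / n`!%:R = (2 * e) ^+ n / n`!%:R * 2^-1 ^+ n :> R.
  have h2 : 2 ^+ n * 2^-1 ^+ n = 1 :> R by rewrite -exprMn divff // expr1n.
  rewrite exprMn -[LHS]mul1r -{1}h2; ring.
rewrite ler_pM2r ?exprn_gt0 ?invr_gt0 //.
have e2 : 0 <= 2 * e by rewrite mulr_ge0 // ltW.
case: n => [|n].
  rewrite expr0 fact0 divr1; apply: le_trans (expR_ge1Dx _).
  by rewrite lerDl.
by apply: le_trans (expR_ge1Dxn n e2); rewrite lerDr.
Qed.

Lemma exp_bounded_fact f :
  exp_bounded f -> exists M : R, forall k n,
    `|f k n / (k + n)`!%:R| <= ofR (geometric M 2^-1 (k + n)).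
Proof.
move=> [E hE hf].
have [|M hM] := @exp_bounded1_fact (fun n => E ^+ n.+1).
  exists E => // n; rewrite ger0_norm // exprn_ge0 //.
  exact: le_trans hE.
exists M => k n; apply: le_trans (hM _).
rewrite !normrM ler_wpM2r //.
by rewrite [leRHS]ger0_norm // exprn_ge0 // (le_trans _ hE).
Qed.

(** The indices below n0 are absorbed by the sum of the first values. *)
Lemma exp_bounded1_ratio h (D : C) n0 :
  0 <= D -> (forall n, (n0 <= n)%N -> `|h n.+1| <= D * `|h n|) -> exp_bounded1 h.
Proof.
move=> D0 hD.
pose S := \sum_(0 <= i < n0.+1) `|h i|.
have S0 : 0 <= S by apply: sumr_ge0.
pose E := 1 + S + D.
have E1 : 1 <= E by rewrite /E -addrA lerDl addr_ge0.
have E0 : 0 <= E := le_trans ler01 E1.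
exists E => // n.
have small m : (m <= n0)%N -> `|h m| <= E ^+ m.+1.
  move=> hm; apply: (@le_trans _ _ E); last by rewrite -[leLHS]expr1 ler_weXn2l.
  apply: (@le_trans _ _ S); last by rewrite /E addrAC lerDr addr_ge0.
  rewrite /S (big_cat_nat (n := m.+1)) //= big_nat_recr //=.
  by rewrite -addrA addrCA lerDl addr_ge0 // sumr_ge0.
elim: n => [|n IH]; first exact: small.
have [hn|hn] := leqP n.+1 n0; first exact: small.
apply: (le_trans (hD n _)) => //; rewrite exprS; apply: ler_pM => //.
by rewrite /E lerDr addr_ge0.
Qed.

Lemma shift_ratio_eventually z :
  exists n0, forall n, (n0 <= n)%N -> n.+1%:R <= 3 * `|z + n%:R|.
Proof.
have [r hr] : exists r : R, `|z| = ofR r by exists (modulus z); exact: modulusE.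
(* n + 1 <= 3 (n - |z|) as soon as 3 |z| + 1 <= 2 n. *)
exists (Num.truncn (3 * r + 1)).+1 => n hn.
have hz : n%:R - `|z| <= `|z + n%:R|.
  by have := lerB_normD (n%:R : C) z; rewrite normr_nat [n%:R + z]addrC.
apply: (@le_trans _ _ (3 * (n%:R - `|z|))); last by rewrite ler_pM2l.
rewrite hr -!ofR_nat -ofRN -ofRD -ofRM ofR_le.
have h1 : 3 * r + 1 < (Num.truncn (3 * r + 1)).+1%:R by exact: truncnS_gt.
have h2 : (Num.truncn (3 * r + 1)).+1%:R <= n%:R :> R by rewrite ler_nat.
have h0 : 0 <= n%:R :> R := ler0n _ _.
rewrite -[n.+1%:R]natr1; lra.
Qed.

(** |z + m + i| <= (|z| + 1) (m + i + 1), and the product of the second factors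
    is n! C(m + n, n). *)
Lemma poch_upper z m n :
  `|poch (z + m%:R) n / n`!%:R| <= (`|z| + 1) ^+ n * 2 ^+ (m + n).
Proof.
have z0 : 0 <= `|z| + 1 by rewrite addr_ge0.
apply: (@le_trans _ _ ((`|z| + 1) ^+ n * 'C(m + n, n)%:R)); last first.
  rewrite ler_wpM2l ?exprn_ge0 // -natrX ler_nat.
  rewrite -[X in (_ <= _ ^ X)%N]card_ord -cardsT -card_powerset.
  by rewrite -[in 'C(_, _)](card_ord (m + n)) -card_draws subset_leq_card //;
    apply/fintype.subsetP => A _; rewrite powersetE finset.subsetT.
have -> : 'C(m + n, n)%:R = poch (m%:R + 1) n / n`!%:R :> C.
  have -> : poch (m%:R + 1) n = (m + n)`!%:R / m`!%:R :> C.
    elim: n => [|n IH]; first by rewrite poch0 addn0 divff ?fact_neq0.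
    by rewrite pochS IH addnS factS natrM -addn1 !natrD; ring.
  by rewrite bin_factE ?leq_addl // addnK -mulrA -invfM [n`!%:R * _]mulrC.
rewrite normrM normfV normr_nat mulrA ler_wpM2r ?invr_ge0 ?ler0n //.
elim: n => [|n IH]; first by rewrite !poch0 normr1 expr0 mulr1.
rewrite !pochS normrM exprS [(`|z| + 1) * _]mulrC mulrACA.
apply: ler_pM => //; rewrite -addrA -natrD.
apply: (le_trans (ler_normD _ _)); rewrite normr_nat.
have -> : m%:R + 1 + n%:R = 1 + (m + n)%:R :> C by rewrite natrD; ring.
by rewrite mulrDr mulr1 mulrDl mul1r -addrA lerD2l addrA lerDr addr_ge0 ?mulr_ge0.
Qed.

Lemma exp_bounded1_poch z : exp_bounded1 (fun n => poch z n / n`!%:R).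
Proof.
exists ((`|z| + 1) * 2) => [|n].
  by rewrite mulr_ege1 // ?lerDr // ler1n.
have := poch_upper z 0 n; rewrite addr0 add0n -exprMn => h.
apply: (le_trans h); rewrite ler_weXn2l //.
by rewrite mulr_ege1 // ?lerDr // ler1n.
Qed.

Lemma exp_bounded_poch_shift z :
  exp_bounded (fun k n => poch (z + (k + n)%:R) k / k`!%:R).
Proof.
have h1 : 1 <= `|z| + 1 by rewrite lerDr.
exists ((`|z| + 1) * 4) => [|k n]; first by rewrite mulr_ege1 // ler1n.
apply: (le_trans (poch_upper _ _ _)).
rewrite exprMn; apply: ler_pM; rewrite ?exprn_ge0 ?ler0n ?addr_ge0 //.
  by rewrite ler_weXn2l //; lia.
by rewrite -!natrX ler_nat -[4%N]/(2 ^ 2)%N -expnM leq_exp2l //; lia.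
Qed.

Lemma exp_bounded1_invpoch z : (forall n, z + n%:R != 0) ->
  exp_bounded1 (fun n => n`!%:R / poch z n).
Proof.
move=> hz; have [n0 hn0] := shift_ratio_eventually z.
apply: (@exp_bounded1_ratio _ 3 n0) => // n hn.
rewrite pochS [poch _ _ * _]mulrC factS natrM invfM mulrACA normrM ler_wpM2r //.
rewrite normrM normfV normr_nat ler_pdivrMr ?normr_gt0 //.
exact: hn0.
Qed.

(** The size of 1 / Gamma (z + n), read off the recurrence alone: the factor
    1 / |z + n| is at most 3 / (n + 1) in the long run. *)
Lemma exp_bounded1_recurrence z (c : nat -> C) :
  (forall n, c n = (z + n%:R) * c n.+1) -> exp_bounded1 (fun n => c n * n`!%:R).
Proof.
move=> hc; have [n0 hn0] := shift_ratio_eventually z.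
apply: (@exp_bounded1_ratio _ 3 n0) => // n hn.
rewrite [c n]hc factS natrM !normrM !normr_nat.
rewrite [leLHS]mulrCA -[_ * _ * n`!%:R]mulrA [leRHS]mulrA.
rewrite ler_wpM2r ?mulr_ge0 //.
exact: hn0.
Qed.

Lemma exp_bounded1_invfact : exp_bounded1 (fun n => (n`!%:R)^-1 : C).
Proof.
exists 1 => // n; rewrite expr1n normfV normr_nat invf_le1 ?ltr0n ?fact_gt0 //.
by rewrite ler1n fact_gt0.
Qed.

Lemma exp_bounded1_exp z : exp_bounded1 (fun n => z ^+ n).
Proof.
exists (`|z| + 1) => [|n]; first by rewrite lerDr.
rewrite normrX; apply: (@le_trans _ _ ((`|z| + 1) ^+ n)).
  by rewrite lerXn2r ?nnegrE ?addr_ge0 // lerDl.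
by rewrite ler_weXn2l // lerDr.
Qed.

Lemma poch_ofR_le (a b : R) n :
  0 < a -> a <= b -> `|poch (ofR a) n| <= `|poch (ofR b) n|.
Proof.
move=> a0 ab; elim: n => [|n IH]; first by rewrite !poch0.
rewrite !pochS !normrM ler_pM // -!ofR_nat -!ofRD !norm_ofR ofR_le.
by rewrite !ger0_norm ?addr_ge0 ?ler0n ?lerD2r //; rewrite ltW // (lt_le_trans a0).
Qed.

(** The n + 1 <= 2^n terms of the sum are products of two generalized binomial
    coefficients, each bounded by [poch_upper]. *)
Lemma exp_bounded1_jacobi_form (a b y w : C) :
  `|y| <= 1 -> `|w| <= 1 -> exp_bounded1 (fun n => jacobi_form n a b y w).
Proof.
move=> hy hw.
pose P := (`|a + 1| + 1) * (`|b + 1| + 1).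
have P1 : 1 <= P by rewrite mulr_ege1 // lerDr.
have P0 : 0 <= P := le_trans ler01 P1.
have E1 : 1 <= P * 8 by rewrite mulr_ege1 // ler1n.
exists (P * 8) => // n.
apply: (@le_trans _ _ ((P * 8) ^+ n)); last by rewrite ler_weXn2l.
have -> : (P * 8) ^+ n = (P * 4) ^+ n * 2 ^+ n.
  by rewrite -exprMn; congr (_ ^+ _); ring.
apply: (@le_trans _ _ (\sum_(0 <= m < n.+1) (P * 4) ^+ n)); last first.
  rewrite sumr_const_nat subn0 -[_ *+ n.+1]mulr_natr ler_wpM2l ?exprn_ge0 ?mulr_ge0 //.
  by rewrite -natrX ler_nat ltn_expl.
apply: (le_trans (ler_norm_sum _ _ _)).
rewrite !big_nat; apply: ler_sum => m /andP[_ hm].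
have -> : (- y) ^+ m * w ^+ (n - m) * poch (a + 1 + m%:R) (n - m) *
   poch (b + 1 + (n - m)%:R) m / (m`!%:R * (n - m)`!%:R) =
   ((- y) ^+ m * w ^+ (n - m)) *
   ((poch (a + 1 + m%:R) (n - m) / (n - m)`!%:R) *
   (poch (b + 1 + (n - m)%:R) m / m`!%:R)).
  by rewrite invfM; ring.
rewrite normrM -[leRHS]mul1r; apply: ler_pM => //.
  rewrite normrM !normrX normrN -[leRHS](mulr1 1).
  by apply: ler_pM; rewrite ?exprn_ge0 ?exprn_ile1.
have -> : (P * 4) ^+ n = (P ^+ n * 2 ^+ n) * 2 ^+ n.
  by rewrite -!exprMn; congr (_ ^+ _); ring.
rewrite normrM.
apply: (@le_trans _ _ (((`|a + 1| + 1) ^+ n * 2 ^+ n) * ((`|b + 1| + 1) ^+ n * 2 ^+ n))).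
  have aux (e : C) i j : (i <= n)%N -> (j + i = n)%N ->
    `|poch (e + j%:R) i / i`!%:R| <= (`|e| + 1) ^+ n * 2 ^+ n.
    move=> hi hj; apply: (le_trans (poch_upper _ _ _)); rewrite hj.
    by rewrite ler_wpM2r ?exprn_ge0 // ler_weXn2l // lerDr.
  by apply: ler_pM => //; apply: aux; lia.
rewrite le_eqVlt; apply/orP; left; apply/eqP; rewrite /P exprMn; ring.
Qed.

End ExponentialBounds.

(** * Principal arguments, powers and square roots *)

Section ComplexPowers.
Variable R : realType.
Local Notation C := (Cplx R).
Implicit Types (z w v : C).

Lemma cexpD z w : cexp (z + w) = cexp z * cexp w.
Proof.
case: z w => [a b] [c d]; rewrite /cexp /= expRD cosD sinD ofRM.
rewrite mulrACA; congr (_ * _).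
by apply/eqP; rewrite eq_complex /=; apply/andP; split; apply/eqP; ring.
Qed.

Lemma cexp0 : cexp (0 : C) = 1.
Proof. by rewrite /cexp /= expR0 cos0 sin0 mulr1. Qed.

Lemma cexp_neq0 z : cexp z != 0.
Proof.
have : cexp z * cexp (- z) != 0 by rewrite -cexpD subrr cexp0 oner_eq0.
by rewrite mulf_eq0 negb_or => /andP[].
Qed.

Lemma cexpMn z n : cexp (n%:R * z) = cexp z ^+ n.
Proof.
elim: n => [|n IH]; first by rewrite mul0r cexp0 expr0.
by rewrite -natr1 mulrDl mul1r cexpD IH exprSr.
Qed.

Lemma modulus_gt0 z : z != 0 -> 0 < modulus z.
Proof. by move=> z0; rewrite -ofR_lt -modulusE normr_gt0. Qed.

Lemma modulus_sqr z : modulus z ^+ 2 = complex.Re z ^+ 2 + complex.Im z ^+ 2.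
Proof. apply: (@ofR_inj R); rewrite ofRX -modulusE; exact: esym (add_Re2_Im2 z). Qed.

Definition expi (t : R) : C := (cos t +i* sin t)%C.

(** The polar form with t in ]-pi, pi] is unique, so the argument of a square can
    be read off by doubling. *)
Lemma carg_polar (r t : R) : 0 < r -> - pi < t <= pi ->
  carg (ofR r * expi t) = t.
Proof.
move=> r0 /andP[t1 t2].
have eRe : complex.Re (ofR r * expi t) = r * cos t.
  by rewrite /= mul0r subr0.
have eIm : complex.Im (ofR r * expi t) = r * sin t.
  by rewrite /= mul0r addr0.
have em : modulus (ofR r * expi t) = r.
  have n1 : `|expi t| = 1.
    by apply: (etrans (normc_def _)); rewrite /= cos2Dsin2 sqrtr1.
  apply: (@ofR_inj R); rewrite -modulusE.
  by rewrite (normrM (ofR r)) n1 mulr1 norm_ofR gtr0_norm.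
rewrite /carg eRe eIm -/(modulus _) em mulrAC divff ?gt_eqF // mul1r pmulr_rge0 //.
case: ifPn => [h|].
  apply: cosK; rewrite in_itv /= t2 andbT leNgt; apply/negP => tn.
  have : 0 < sin (- t) by rewrite sin_gt0_pi // oppr_gt0 tn ltrNl.
  by rewrite sinN oppr_gt0 ltNge h.
rewrite -ltNge => h.
rewrite cosKN ?opprK // ltW //= leNgt; apply/negP => tp.
have : 0 <= sin t by rewrite sin_ge0_pi // ltW.
by rewrite leNgt h.
Qed.

Lemma polar_carg z : z != 0 ->
  z = ofR (modulus z) * expi (carg z) /\ - pi < carg z <= pi.
Proof.
move=> z0; have m0 := modulus_gt0 z0; have ms := modulus_sqr z.
have mn0 : modulus z != 0 by rewrite gt_eqF.
set t := complex.Re z / modulus z.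
have t2 : 1 - t ^+ 2 = (complex.Im z / modulus z) ^+ 2.
  by rewrite /t !exprMn exprVn -[1](divff (_ : modulus z ^+ 2 != 0)) ?expf_neq0 //
    -mulrBl ms; congr (_ / _); ring.
have t1 : -1 <= t <= 1.
  have : 0 <= 1 - t ^+ 2 by rewrite t2 sqr_ge0.
  by move=> h; apply/andP; split; nra.
have pi0 := pi_gt0 R.
have ecos : cos (acos t) = t by apply: acosK; rewrite in_itv.
have esin : sin (acos t) = `|complex.Im z / modulus z|.
  by rewrite sin_acos // t2 sqrtr_sqr.
have key : cos (carg z) = t /\ sin (carg z) = complex.Im z / modulus z.
  rewrite /carg -/(modulus z) -/t; case: ifPn => [h|].
    by rewrite ecos esin ger0_norm // divr_ge0 // ltW.
  rewrite -ltNge => h; rewrite cosN sinN ecos esin ltr0_norm ?opprK //.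
  by rewrite pmulr_llt0 // invr_gt0.
split.
  rewrite /expi key.1 key.2; apply/eqP; rewrite eq_complex /= !mul0r subr0 addr0.
  by rewrite /t ![modulus z * _]mulrC !divfK // !eqxx.
rewrite /carg -/(modulus z) -/t; case: ifPn => [h|].
  by rewrite acos_lepi // andbT (lt_le_trans _ (acos_ge0 t1)) // oppr_lt0.
rewrite -ltNge => h; rewrite ltrN2 acos_ltpi; last first.
  have : 0 < 1 - t ^+ 2.
    by rewrite t2 exprn_even_gt0 //= mulf_neq0 ?invr_neq0 // lt_eqF.
  by case/andP: t1 => h1 ->; rewrite andbT; nra.
by rewrite /= (le_trans _ (ltW pi0)) // oppr_le0 acos_ge0.
Qed.

Lemma cexp_clog z : z != 0 -> cexp (clog z) = z.
Proof.
move=> z0; have [ez _] := polar_carg z0.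
by rewrite /cexp /= lnK ?posrE ?modulus_gt0 // -ez.
Qed.

(** The values of the principal square root at nonzero numbers: the half-plane
    on which doubling the argument stays within ]-pi, pi]. *)
Definition principal_root v : Prop :=
  0 < complex.Re v \/ complex.Re v = 0 /\ 0 < complex.Im v.

Lemma principal_root_neq0 v : principal_root v -> v != 0.
Proof.
by case=> [h|[_ h]]; apply/eqP => v0; move: h; rewrite v0 /= ltxx.
Qed.

Lemma carg_principal_root v : principal_root v -> - (pi / 2) < carg v <= pi / 2.
Proof.
move=> hv; have v0 := principal_root_neq0 hv.
have [ev /andP[a1 a2]] := polar_carg v0; have m0 := modulus_gt0 v0.
have pi0 := pi_gt0 R.
have eRe : complex.Re v = modulus v * cos (carg v).
  by rewrite {1}ev /= mul0r subr0.
have eIm : complex.Im v = modulus v * sin (carg v).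
  by rewrite {1}ev /= mul0r addr0.
have Re0 : 0 <= cos (carg v).
  by rewrite -(pmulr_rge0 _ m0) -eRe; case: hv => [/ltW //|[-> _]].
apply/andP; split; rewrite ltNge || rewrite leNgt; apply/negP => h.
  have hs : sin (carg v) < 0.
    by rewrite -oppr_gt0 -sinN sin_gt0_pi //; apply/andP; split; lra.
  have hc : cos (carg v) <= 0.
    rewrite -cosN -(cos_pihalf R) leNgt ltr_cos ?in_itv /= -?leNgt; lra.
  case: hv => [|[_]]; rewrite ?eRe ?eIm pmulr_rgt0 // ltNge ?hc //.
  by rewrite ltW.
have : cos (carg v) < cos (pi / 2) by rewrite ltr_cos // in_itv /=; lra.
by rewrite cos_pihalf ltNge Re0.
Qed.

Lemma clog_sqr v : principal_root v -> clog (v ^+ 2) = 2 * clog v.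
Proof.
move=> hv; have v0 := principal_root_neq0 hv; have m0 := modulus_gt0 v0.
have /andP[a1 a2] := carg_principal_root hv.
have [ev _] := polar_carg v0.
have em : modulus (v ^+ 2) = modulus v ^+ 2.
  by apply: (@ofR_inj R); rewrite ofRX -!modulusE normrX.
have ea : carg (v ^+ 2) = 2 * carg v.
  have -> : v ^+ 2 = ofR (modulus v ^+ 2) * expi (2 * carg v).
    rewrite {1}ev exprMn ofRX; congr (_ * _).
    have -> : 2 * carg v = carg v + carg v by ring.
    by rewrite /expi cosD sinD expr2; apply/eqP; rewrite eq_complex /=;
      apply/andP; split; apply/eqP; ring.
  by apply: carg_polar; [rewrite exprn_gt0 | lra].
rewrite /clog ea -/(modulus _) em lnXn //.
have -> : (2 : C) = ofR 2 by rewrite -ofR_nat.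
apply/eqP; rewrite eq_complex /= !mul0r subr0 addr0 -/(modulus _).
by apply/andP; split; apply/eqP; ring.
Qed.

Lemma csqrt_sqr z : csqrt z ^+ 2 = z.
Proof. exact: sqr_sqrtc. Qed.

Lemma csqrt_half_sqr w : (csqrt w / 2) ^+ 2 = w / 4.
Proof. by rewrite exprMn csqrt_sqr exprVn; congr (_ / _); ring. Qed.

Lemma principal_root_csqrt z : z != 0 -> principal_root (csqrt z).
Proof.
move=> z0.
have Re0 : 0 <= complex.Re (csqrt z) by case: (z) => a b /=; rewrite sqrtr_ge0.
have [h|h] := eqVneq (complex.Re (csqrt z)) 0; last by left; rewrite lt_neqAle eq_sym h.
right; split => //.
have Im0 : complex.Im z = 0.
  rewrite -(csqrt_sqr z) expr2; move: h; case: (csqrt z) => a b /= ->; ring.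
rewrite lt_neqAle; apply/andP; split.
  apply/negP => /eqP h2; move/eqP: z0; apply; rewrite -(csqrt_sqr z).
  by move: h h2; case: (csqrt z) => a b /= -> <-; rewrite expr0n.
by move: Im0; case: (z) => a b /= ->; rewrite eqxx mul1r sqrtr_ge0.
Qed.

Lemma principal_root_half v : principal_root v -> principal_root (v / 2).
Proof.
have -> : v / 2 = v * ofR 2^-1 by rewrite ofRV -ofR_nat.
case: v => a b; rewrite /principal_root /= !mulr0 subr0 add0r.
case=> [h|[-> h]]; first by left; rewrite mulr_gt0.
by right; rewrite mul0r mulr_gt0.
Qed.

Lemma cpowE z s : z != 0 -> cpow z s = cexp (s * clog z).
Proof. by rewrite /cpow => /negPf ->. Qed.

(** Since w / 4 = (csqrt w / 2)^2 and the logarithm doubles accordingly, the two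
    powers are exponentials of opposite numbers. *)
Lemma cpow_csqrt_cancel w s : w != 0 ->
  cpow (w / 4) (- (s / 2)) * cpow (csqrt w / 2) s = 1.
Proof.
move=> w0; have hv := principal_root_half (principal_root_csqrt w0).
have v0 := principal_root_neq0 hv.
rewrite -csqrt_half_sqr !cpowE ?expf_neq0 // clog_sqr // -cexpD.
by rewrite (_ : _ + _ = 0) ?cexp0 //; field.
Qed.

Lemma cpow_addn v n s : v != 0 -> cpow v (2 * n%:R + s) = (v ^+ 2) ^+ n * cpow v s.
Proof.
move=> v0; rewrite !cpowE // mulrDl cexpD; congr (_ * _).
by rewrite -exprM -[in RHS](cexp_clog v0) -cexpMn natrM.
Qed.

End ComplexPowers.

(** * Euler's limit on the real line *)

Section ReciprocalGamma.
Variable R : realType.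
Local Notation C := (Cplx R).
Implicit Types (z : C) (a : R).

Definition euler_sequence z (n : nat) : C := poch z n.+1 / (n`!%:R * cpow n%:R z).

Lemma cvg_invn_Cplx z : z / n%:R @[n --> \oo] --> (0 : C).
Proof.
apply: (@cvg_dominated _ _ _ (fun n => modulus z / n%:R)).
  move=> n; rewrite sub0r normrN normrM modulusE normfV normr_nat ofRM ofRV.
  by rewrite ofR_nat.
rewrite -(mulr0 (modulus z)); apply: cvgM; first exact: cvg_cst.
rewrite -(cvg_shiftS (fun n => n%:R^-1 : R)).
exact: cvg_harmonic.
Qed.

Lemma euler_sequence_shift z n : (0 < n)%N ->
  euler_sequence z n * (1 + (z + 1) / n%:R) = z * euler_sequence (z + 1) n.
Proof.
move=> n0; have n0' : n%:R != 0 :> C by rewrite pnatr_eq0 -lt0n.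
rewrite /euler_sequence.
have -> : cpow n%:R (z + 1) = cpow n%:R z * n%:R.
  by rewrite !cpowE // mulrDl mul1r cexpD cexp_clog.
have c0 : cpow n%:R z != 0 by rewrite cpowE // cexp_neq0.
have e : z * poch (z + 1) n.+1 = poch z n.+1 * (z + 1 + n%:R).
  by rewrite -pochSl pochS -[n.+1%:R]natr1 addrAC addrA.
transitivity (poch z n.+1 * (z + 1 + n%:R) / (n`!%:R * cpow n%:R z * n%:R)).
  by field; rewrite n0' c0 fact_neq0.
by rewrite -e; field; rewrite n0' c0 fact_neq0.
Qed.

(** The ratio of z times the sequence at z + 1 to the sequence at z is
    1 + (z + 1) / n, which tends to 1. *)
Lemma rgamma_shift z : cvgn (euler_sequence (z + 1)) ->
  cvgn (euler_sequence z) /\ rgamma z = z * rgamma (z + 1).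
Proof.
move=> hc.
have h1 : (1 + (z + 1) / n%:R)^-1 @[n --> \oo] --> (1 : C).
  rewrite -[X in _ --> X]invr1; apply: cvgV; first exact: oner_neq0.
  rewrite -[X in _ --> X]addr0; apply: cvgD; first exact: cvg_cst.
  exact: cvg_invn_Cplx.
have h2 : euler_sequence z n @[n --> \oo] --> z * rgamma (z + 1).
  have h : z * euler_sequence (z + 1) n * (1 + (z + 1) / n%:R)^-1
      @[n --> \oo] --> z * rgamma (z + 1).
    rewrite -[X in _ --> X]mulr1; apply: cvgM h1.
    by apply: cvgM hc; exact: cvg_cst.
  apply: cvg_trans h; apply: near_eq_cvg.
  have [n0 hn0] := shift_ratio_eventually (z + 1).
  exists n0.+1 => // n /= hn.
  have n1 : (0 < n)%N by apply: leq_trans hn.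
  have nC : n%:R != 0 :> C by rewrite pnatr_eq0 -lt0n.
  rewrite /= -(euler_sequence_shift _ n1) mulfK //.
  have : 0 < 3 * `|z + 1 + n%:R| by apply: lt_le_trans (hn0 n (ltnW hn)); rewrite ltr0n.
  rewrite pmulr_rgt0 // normr_gt0 => hz.
  have -> : 1 + (z + 1) / n%:R = (z + 1 + n%:R) / n%:R by field.
  by rewrite mulf_neq0 ?invr_neq0.
split; first by apply/cvg_ex; eexists; exact: h2.
exact: limn_unique h2.
Qed.

Lemma euler_sequence_ofR a n : (0 < n)%N ->
  euler_sequence (ofR a) n =
  ofR ((\prod_(i < n.+1) (a + i%:R)) / (n`!%:R * expR (a * ln n%:R))).
Proof.
move=> n0; have n0' : n%:R != 0 :> C by rewrite pnatr_eq0 -lt0n.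
rewrite /euler_sequence ofRM ofRV ofRM ofR_nat; congr (_ / (_ * _)).
  rewrite /poch [RHS](rmorph_prod (real_complex R)).
  by apply: eq_bigr => i _; rewrite -ofR_nat -ofRD.
rewrite cpowE //.
have -> : clog (n%:R : C) = ofR (ln n%:R).
  have -> : n%:R = ofR n%:R * expi 0 :> C.
    by rewrite ofR_nat /expi cos0 sin0 mulr1.
  have m : modulus (ofR (n%:R : R) * expi 0) = n%:R.
    apply: (@ofR_inj R); rewrite -modulusE.
    have -> : ofR n%:R * expi 0 = ofR n%:R :> C.
      by rewrite /expi cos0 sin0 mulr1.
    by rewrite norm_ofR normr_nat.
  rewrite /clog -/(modulus _) m carg_polar //; first by rewrite ltr0n.
  by rewrite oppr_lt0 pi_gt0 ltW // pi_gt0.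
by rewrite -ofRM /cexp /= cos0 sin0 mulr1.
Qed.

(** For a >= 0 Euler's sequence decreases, because
    1 + a / (n + 1) <= exp (a / (n + 1)) <= (1 + 1 / n)^a. *)
Lemma cvg_euler_sequence_ge0 a : 0 <= a -> cvgn (euler_sequence (ofR a)).
Proof.
move=> a0.
pose g n : R := (\prod_(i < n.+1) (a + i%:R)) / (n`!%:R * expR (a * ln n%:R)).
have g0 n : 0 <= g n.
  by rewrite divr_ge0 ?mulr_ge0 ?expR_ge0 ?ler0n // prodr_ge0 // => i _; rewrite addr_ge0.
have dec n : g n.+2 <= g n.+1.
  have n0 : 0 < n.+1%:R :> R by rewrite ltr0n.
  have n1 : 0 < n.+2%:R :> R by rewrite ltr0n.
  have key : (a + n.+2%:R) * expR (a * ln n.+1%:R) <= n.+2%:R * expR (a * ln n.+2%:R).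
    have -> : a + n.+2%:R = n.+2%:R * (1 + a / n.+2%:R) by field; rewrite gt_eqF.
    rewrite -mulrA ler_pM2l //.
    apply: (@le_trans _ _ (expR (a / n.+2%:R) * expR (a * ln n.+1%:R))).
      by rewrite ler_wpM2r ?expR_ge0 ?expR_ge1Dx.
    rewrite -expRD ler_expR -mulrDr ler_wpM2l //.
    rewrite -lerBrDr -opprB lerNr -ln_div ?posrE //.
    have -> : n.+1%:R / n.+2%:R = 1 + - n.+2%:R^-1 :> R.
      by rewrite -[n.+1%:R](addrK 1) natr1 mulrBl divff ?gt_eqF // mul1r.
    by apply: le_ln1Dx; rewrite ltrN2 invf_lt1 // ltr1n.
  rewrite /g big_ord_recr /= factS natrM.
  rewrite ler_pdivrMr ?mulr_gt0 ?expR_gt0 ?ltr0n ?fact_gt0 //.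
  set P := \prod_(i < _) _.
  have P0 : 0 <= P by apply: prodr_ge0 => i _; rewrite addr_ge0.
  rewrite mulrAC ler_pdivlMr ?mulr_gt0 ?expR_gt0 ?ltr0n ?fact_gt0 //.
  have f0 : 0 <= P * (n.+1)`!%:R by rewrite mulr_ge0.
  have := ler_wpM2l f0 key; congr (_ <= _); ring.
have : cvgn (fun n => g n.+1).
  apply: nonincreasing_is_cvgn; last by exists 0 => _ [n _ <-].
  by apply/nonincreasing_seqP => n; exact: dec.
move=> /cvg_ofR h; apply/cvg_ex; eexists.
rewrite -cvg_shiftS; apply: cvg_trans h; apply: near_eq_cvg; apply: nearW => n /=.
by rewrite euler_sequence_ofR.
Qed.

(** Descend from a + m >= 0 by unit steps. *)
Lemma cvg_euler_sequence_real a : cvgn (euler_sequence (ofR a)).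
Proof.
have [m hm] : exists m : nat, 0 <= a + m%:R.
  exists (Num.truncn `|a|).+1.
  have h1 : `|a| < (Num.truncn `|a|).+1%:R by exact: truncnS_gt.
  by rewrite -lerBlDl sub0r (le_trans (ler_norm _)) // normrN ltW.
elim: m a hm => [|m IH] a hm.
  by apply: cvg_euler_sequence_ge0; move: hm; rewrite addr0.
apply: (rgamma_shift _).1; rewrite -ofR1 -ofRD; apply: IH.
by rewrite -addrA nat1r.
Qed.

Lemma rgamma_real_recurrence a :
  rgamma (ofR a) = ofR a * rgamma (ofR a + 1) :> C.
Proof.
by apply: (rgamma_shift _).2; rewrite -ofR1 -ofRD; exact: cvg_euler_sequence_real.
Qed.

End ReciprocalGamma.

(** * Bessel functions as power series *)

Section BesselSeries.
Variable R : realType.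
Local Notation C := (Cplx R).
Implicit Types (a b z w e : C) (c : nat -> C).

Definition bessel_term c z (n : nat) : C := c n * (z ^+ n / n`!%:R).

Definition bessel_series c z : C := csum (bessel_term c z).

Lemma bessel_term_bounded a c z :
  (forall n, c n = (a + n%:R) * c n.+1) ->
  exists M : R, geometrically_bounded M (bessel_term c z).
Proof.
move=> hc.
have [M hM] := exp_bounded1_fact (exp_bounded1M (exp_bounded1M
  (exp_bounded1_recurrence hc) (exp_bounded1_exp z)) (exp_bounded1_invfact R)).
exists M => n; apply: le_trans (hM n); rewrite le_eqVlt; apply/orP; left; apply/eqP.
congr `|_|; rewrite /bessel_term; field; exact: fact_neq0.
Qed.

Lemma bessel_seriesZ a c z (l : C) :
  (forall n, c n = (a + n%:R) * c n.+1) ->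
  bessel_series (fun n => l * c n) z = l * bessel_series c z.
Proof.
move=> hc; have [M hM] := bessel_term_bounded z hc.
rewrite /bessel_series -(csumZ _ hM); congr csum; apply/funext => n.
by rewrite /bessel_term -mulrA.
Qed.

(** For |r| <= 1, the terms of positive index at e r are bounded by |r| times
    those at e, so the difference with the value at 0 is O(|r|). *)
Lemma bessel_series_continuous0 a c e :
  (forall n, c n = (a + n%:R) * c n.+1) ->
  bessel_series c (e * r) @[r --> (0 : C)^'] --> bessel_series c (e * 0).
Proof.
move=> hc; have [M hM] := bessel_term_bounded e hc.
have [M1 hM1] : exists M1 : R, 0 < M1 /\ geometrically_bounded M1 (bessel_term c e).
  exists (`|M| + 1); split; first by rewrite ltr_wpDl.
  move=> n; apply: le_trans (hM n) _; rewrite ofR_le /= ler_wpM2r ?exprn_ge0 //.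
  by rewrite (le_trans (ler_norm _)) // lerDl.
case: hM1 => M0 {}hM1.
have bound (r : C) : `|r| <= 1 ->
    `|bessel_series c (e * 0) - bessel_series c (e * r)| <= `|r| * ofR (M1 * 2).
  move=> hr.
  have [N1 hN1] := bessel_term_bounded (e * r) hc.
  have [N0 hN0] := bessel_term_bounded (e * 0) hc.
  have hd : geometrically_bounded (modulus r * M1)
      (fun n => bessel_term c (e * 0) n - bessel_term c (e * r) n).
    move=> [|n].
      rewrite /bessel_term !expr0 subrr normr0 -ofR0 ofR_le /= mulr_ge0 ?exprn_ge0 //.
      by rewrite mulr_ge0 ?(ltW M0) // -ofR_le ofR0 -modulusE.
    rewrite /bessel_term mulr0 expr0n mul0r mulr0 sub0r normrN exprMn.
    have -> : c n.+1 * (e ^+ n.+1 * r ^+ n.+1 / (n.+1)`!%:R)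
       = bessel_term c e n.+1 * r ^+ n.+1 by rewrite /bessel_term; ring.
    rewrite normrM mulrC /= -mulrA ofRM -modulusE.
    apply: ler_pM => //; rewrite normrX exprS ler_piMr // exprn_ile1 //.
  have := csum_bounded hd; rewrite -mulrA ofRM -modulusE; apply: le_trans.
  rewrite le_eqVlt; apply/orP; left; apply/eqP; congr `|_|; symmetry.
  apply: limn_unique.
  set u := (X in series X).
  have -> : series u = series (bessel_term c (e * 0)) \- series (bessel_term c (e * r)).
    by apply/funext => n; rewrite /series /= sumrB.
  exact: cvgB (cvg_csum hN0) (cvg_csum hN1).
apply/cvgrPdist_lt => eps eps0.
have d0 : 0 < eps / ofR (M1 * 2).
  by rewrite divr_gt0 // -ofR0 ofR_lt mulr_gt0.
near=> r.
have hr1 : `|r| < 1.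
  near: r; apply: cvg_within; exists 1 => //= r /=.
  by rewrite sub0r normrN.
have hr2 : `|r| < eps / ofR (M1 * 2).
  near: r; apply: cvg_within; exists (eps / ofR (M1 * 2)) => //= r /=.
  by rewrite sub0r normrN.
apply: le_lt_trans (bound _ (ltW hr1)) _.
by rewrite -ltr_pdivlMr // -ofR0 ofR_lt mulr_gt0.
Unshelve. all: by end_near.
Qed.

(** 1 / Gamma (a + 1 + n), expressed by 1 / Gamma (a + 1) where the latter may be
    divided by (a + 1)_n, so that the recurrence below is algebraic there; at the
    remaining parameters a is an integer and Euler's limit is known to exist. *)
Definition inv_gamma_coeff a (n : nat) : C :=
  if `[< nonposint (a + 1) >] then rgamma (a + 1 + n%:R)
  else rgamma (a + 1) / poch (a + 1) n.

Lemma not_nonposint z : ~ nonposint z -> forall n : nat, z + n%:R != 0.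
Proof.
move=> h n; apply/negP => /eqP e; apply: h; exists n.
by apply/eqP; rewrite -addr_eq0 e.
Qed.

Lemma invpoch_recurrence z n : (forall i : nat, z + i%:R != 0) ->
  (poch z n)^-1 = (z + n%:R) * (poch z n.+1)^-1.
Proof. by move=> hz; rewrite pochS invfM mulrCA divff // mulr1. Qed.

Lemma inv_gamma_coeffS a n :
  inv_gamma_coeff a n = (a + 1 + n%:R) * inv_gamma_coeff a n.+1.
Proof.
rewrite /inv_gamma_coeff; case: asboolP => [[m hm]|/not_nonposint h].
  have -> : a + 1 = ofR (- m%:R) by rewrite hm ofRN ofR_nat.
  by rewrite -ofR_nat -[in LHS]ofRD rgamma_real_recurrence ofRD !ofR_nat -addrA natr1.
by rewrite invpoch_recurrence // mulrCA.
Qed.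

Lemma inv_gamma_coeff_real (a : R) n :
  inv_gamma_coeff (ofR a) n = rgamma (ofR a + 1 + n%:R).
Proof.
rewrite {1}/inv_gamma_coeff; case: asboolP => // /not_nonposint h.
elim: n => [|n IH]; first by rewrite poch0 divr1 addr0.
apply: (mulfI (h n)); rewrite mulrCA -invpoch_recurrence // IH.
have -> : ofR a + 1 + n%:R = ofR (a + 1 + n%:R) by rewrite !ofRD ofR_nat.
by rewrite rgamma_real_recurrence !ofRD ofR_nat -!addrA natr1.
Qed.

(** The two branches in the definition of the Bessel functions, [p] standing for
    the power in front of the series. *)
Lemma bessel_branches a z (p : C) :
  (if `[< nonposint (a + 1) >] then
     csum (fun n => p * (z ^+ n / n`!%:R * rgamma (a + n%:R + 1)))
   else p * rgamma (a + 1) * hyper [::] [:: a + 1] z)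
  = p * bessel_series (inv_gamma_coeff a) z.
Proof.
have [M hM] := bessel_term_bounded z (inv_gamma_coeffS a).
rewrite /bessel_series -(csumZ _ hM) /bessel_term /inv_gamma_coeff.
case: asboolP => [_|/not_nonposint h].
  by congr csum; apply/funext => n; rewrite [a + n%:R + 1]addrAC; ring.
have [N hN] := bessel_term_bounded z (fun n => invpoch_recurrence n h).
have -> : hyper [::] [:: a + 1] z = bessel_series (fun n => (poch (a + 1) n)^-1) z.
  congr csum; apply/funext => n.
  by rewrite /hyper_term big_nil big_seq1 mul1r.
rewrite -(csumZ _ hN); congr csum; apply/funext => n.
by rewrite /bessel_term -!mulrA.
Qed.

Lemma besselJ_series a w : w != 0 ->
  besselJ a (csqrt w) =
  cpow (csqrt w / 2) a * bessel_series (inv_gamma_coeff a) (- (w / 4)).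
Proof.
move=> w0; have v0 := principal_root_neq0 (principal_root_half (principal_root_csqrt w0)).
rewrite -bessel_branches /besselJ /cgamma invrK csqrt_sqr.
case: asboolP => // _; congr csum; apply/funext => n.
by rewrite cpow_addn // csqrt_half_sqr [(- (w / 4)) ^+ n]exprNn; ring.
Qed.

Lemma besselI_series a w : w != 0 ->
  besselI a (csqrt w) =
  cpow (csqrt w / 2) a * bessel_series (inv_gamma_coeff a) (w / 4).
Proof.
move=> w0; have v0 := principal_root_neq0 (principal_root_half (principal_root_csqrt w0)).
rewrite -bessel_branches /besselI /cgamma invrK csqrt_sqr.
case: asboolP => // _; congr csum; apply/funext => n.
by rewrite cpow_addn // csqrt_half_sqr; ring.
Qed.

Lemma bessel_product_series a b x r : 1 - x != 0 -> 1 + x != 0 -> r != 0 ->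
  bessel_product a b x r =
  bessel_series (inv_gamma_coeff a) (- ((1 - x) / 2) * r)
    * bessel_series (inv_gamma_coeff b) ((1 + x) / 2 * r).
Proof.
move=> h1 h2 r0; rewrite /bessel_product.
have two : (2 : C) != 0 by rewrite pnatr_eq0.
have w1 : 2 * (1 - x) * r != 0 by rewrite !mulf_neq0.
have w2 : 2 * (1 + x) * r != 0 by rewrite !mulf_neq0.
rewrite besselJ_series // besselI_series //.
have c1 := cpow_csqrt_cancel a w1; have c2 := cpow_csqrt_cancel b w2.
have e1 : 2 * (1 - x) * r / 4 = (1 - x) * r / 2 by field.
have e2 : 2 * (1 + x) * r / 4 = (1 + x) * r / 2 by field.
have -> : - ((1 - x) / 2) * r = - (2 * (1 - x) * r / 4) by field.
have -> : (1 + x) / 2 * r = 2 * (1 + x) * r / 4 by field.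
rewrite -e1 -e2.
set B1 := bessel_series _ _; set B2 := bessel_series _ _.
transitivity ((cpow (2 * (1 - x) * r / 4) (- (a / 2))
    * cpow (csqrt (2 * (1 - x) * r) / 2) a)
  * (cpow (2 * (1 + x) * r / 4) (- (b / 2))
    * cpow (csqrt (2 * (1 + x) * r) / 2) b) * (B1 * B2)).
  move: (cpow _ _) (cpow _ _) (cpow _ _) (cpow _ _) => p1 q1 p2 q2; ring.
by rewrite c1 c2 !mul1r.
Qed.

Lemma poch_opp_nat n i : (i <= n)%N ->
  poch (- n%:R : C) i = (-1) ^+ i * n`!%:R / (n - i)`!%:R.
Proof.
elim: i => [|i IH] hi; first by rewrite poch0 expr0 mul1r subn0 divff ?fact_neq0.
rewrite pochS IH 1?ltnW //.
have e : (n - i = (n - i.+1).+1)%N by lia.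
have f0 := @fact_neq0 R (n - i.+1).
have n0 : (n - i.+1).+1%:R != 0 :> C by rewrite pnatr_eq0.
have -> : - n%:R + i%:R = - (n - i.+1).+1%:R :> C.
  by rewrite -e (natrB _ (ltnW hi)) opprB addrC.
rewrite e factS natrM exprS invfM; move: n0 f0.
move: ((n - i.+1).+1%:R : C) ((n - i.+1)`!%:R : C) => u v u0 v0.
by field; rewrite u0 v0.
Qed.

(** The defining hypergeometric sum is the expansion in powers of
    (1 - z) / 2 that [jacobi_form_power] gives after the exchange of ends. *)
Lemma jacobiE n a b z : (forall i : nat, a + 1 + i%:R != 0) ->
  jacobi n a b z = jacobi_form n a b ((1 - z) / 2) ((1 + z) / 2).
Proof.
move=> ha; set y := (1 - z) / 2.
have -> : (1 + z) / 2 = 1 - y by rewrite /y; field.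
rewrite jacobi_form_sym jacobi_form_power /jacobi /hyper -/y.
rewrite (@csum_finite _ _ n.+1); last first.
  move=> i hi; rewrite /hyper_term big_cons (_ : poch (- n%:R) i = 0) ?mul0r //.
  by rewrite -(subnKC hi) pochD pochS addNr mulr0 mul0r.
rewrite !mulr_sumr !big_nat; apply: eq_bigr => i /andP[_ hi].
rewrite /hyper_term !big_cons !big_nil !mulr1 poch_opp_nat //.
have -> : n%:R + b + a + 1 = n%:R + a + b + 1 by ring.
have p0 : poch (a + 1) i != 0 by apply: poch_neq0.
have -> : poch (a + 1) n = poch (a + 1) i * poch (a + 1 + i%:R) (n - i).
  by rewrite -pochD subnKC.
have -> : (-1) ^+ n = (-1) ^+ (n - i) * (-1) ^+ i :> C by rewrite -exprD subnK.
have h : (-1) ^+ (n - i) * (-1) ^+ (n - i) = 1 :> C by rewrite -expr2 sqrr_sign.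
rewrite !mulrA.
transitivity (((-1) ^+ (n - i) * (-1) ^+ (n - i)) * ((-1) ^+ i
  * poch (n%:R + a + b + 1) i * poch (a + 1 + i%:R) (n - i)
  / (i`!%:R * (n - i)`!%:R) * y ^+ i)); last by ring.
by rewrite h; field; rewrite !fact_neq0 p0.
Qed.

End BesselSeries.

(** * The double series *)

Section Expansion.
Variable R : realType.
Local Notation C := (Cplx R).

Lemma ofR_shift_neq0 (r : R) : -1 < r -> r != 0 -> forall i : nat, ofR r + i%:R != 0.
Proof.
move=> r1 r0 [|i]; first by rewrite addr0 ofR_eq0.
rewrite -ofR_nat -ofRD ofR_eq0 gt_eqF // -[i.+1%:R]natr1 addrA addrAC.
by rewrite ltr_wpDr ?ler0n // -ltrBlDr sub0r.
Qed.

Lemma sum_gtN1 (b g : R) : -1 < b -> -1 < g -> -1 < g + b + 1.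
Proof. by move=> hb hg; lra. Qed.

Lemma ofR1D_shift_neq0 (r : R) : -1 < r -> forall i : nat, ofR r + 1 + i%:R != 0.
Proof.
move=> hr i; rewrite -ofR1 -ofRD ofR_shift_neq0 //; first by lra.
by rewrite gt_eqF //; lra.
Qed.

Variables (alpha rho : C) (beta gamma x : R) (c : nat -> C).
Hypotheses (beta_gt : -1 < beta) (gamma_gt : -1 < gamma).
Hypothesis sum_neq0 : gamma + beta + 1 != 0.
Hypothesis x_in : -1 < x < 1.

Let b : C := ofR beta.
Let g : C := ofR gamma.
Let s : C := g + b + 1.
Let A : C := alpha + b + 1.
Let y : C := (1 - ofR x) / 2.
Let w : C := (1 + ofR x) / 2.

(** [c n] stands for 1 / Gamma (alpha + 1 + n). *)
Definition hyper_factor_term (k n : nat) : C :=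
  poch (alpha - g) n * poch (A + (k + n)%:R) k / poch (s + (2 * k).+1%:R) n
    * c (k + n)%N * (rho ^+ n / n`!%:R).

(** The right-hand side as a double series, divided by s = gamma + beta + 1.
    Together with the 4^-k of [hyper_factor], the factors of the k-th summand
    that depend on s and k alone amount to s / (s + k)_k. *)
Definition double_term (k n : nat) : C :=
  (poch (s + k%:R) k * poch (b + 1) k)^-1 * rho ^+ k * jacobi k g b (ofR x)
    * hyper_factor_term k n.

Lemma sE : s = ofR (gamma + beta + 1).
Proof. by rewrite /s /g /b !ofRD. Qed.

Lemma s_shift_neq0 (i : nat) : s + i%:R != 0.
Proof. by rewrite sE; apply: ofR_shift_neq0 => //; exact: sum_gtN1. Qed.

Lemma poch_s_neq0 (j n : nat) : poch (s + j%:R) n != 0.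
Proof.
by apply: poch_neq0 => i _; rewrite -addrA -natrD; exact: s_shift_neq0.
Qed.

Lemma poch_b_neq0 n : poch (b + 1) n != 0.
Proof. by apply: poch_neq0 => i _; exact: ofR1D_shift_neq0. Qed.

Lemma invpoch_s_le (j n : nat) : (0 < j)%N ->
  `|n`!%:R / poch (s + j%:R) n| <= `|n`!%:R / poch (s + 1) n|.
Proof.
move=> j0; rewrite !normrM !normfV ler_wpM2l // lef_pV2 ?posrE ?normr_gt0 //.
- have -> : s + 1 = ofR (gamma + beta + 1 + 1) by rewrite [RHS]ofRD -sE.
  have -> : s + j%:R = ofR (gamma + beta + 1 + j%:R) by rewrite [RHS]ofRD -sE ofR_nat.
  apply: poch_ofR_le; first by rewrite -ltrBlDr sub0r; exact: sum_gtN1.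
  by rewrite lerD2l ler1n.
- exact: poch_s_neq0.
- exact: (poch_s_neq0 1).
Qed.

Lemma y_le1 : `|y| <= 1.
Proof.
case/andP: x_in => h1 h2.
have -> : y = ofR ((1 - x) / 2) by rewrite /y [RHS]ofRM ofRV ofR_nat (ofRD 1) ofRN.
by rewrite norm_ofR -ofR1 ofR_le ler_norml; apply/andP; split; lra.
Qed.

Lemma w_le1 : `|w| <= 1.
Proof.
case/andP: x_in => h1 h2.
have -> : w = ofR ((1 + x) / 2) by rewrite /w [RHS]ofRM ofRV ofR_nat (ofRD 1).
by rewrite norm_ofR -ofR1 ofR_le ler_norml; apply/andP; split; lra.
Qed.

Lemma yE : y = 1 - w.
Proof. by rewrite /y /w; field. Qed.

Lemma jacobi_formE k : jacobi k g b (ofR x) = jacobi_form k g b y w.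
Proof. by apply: jacobiE; exact: ofR1D_shift_neq0. Qed.

Hypothesis c_rec : forall n, c n = (alpha + 1 + n%:R) * c n.+1.

(** The factorials are distributed so that each Pochhammer symbol is measured by
    the factorial of its length, and c by (k + n)!. *)
Lemma hyper_factor_term_exp_bounded :
  exp_bounded (fun k n => hyper_factor_term k n * ((k + n)`!%:R / k`!%:R)).
Proof.
have H1 := exp_bounded_r (exp_bounded1_poch (alpha - g)).
have H2 := exp_bounded_poch_shift A.
have H3 : exp_bounded (fun k n => n`!%:R / poch (s + (2 * k).+1%:R) n).
  apply: exp_bounded_le (exp_bounded_r (@exp_bounded1_invpoch R (s + 1) _)).
    by move=> k n; apply: invpoch_s_le.
  by move=> n; rewrite -addrA nat1r; exact: s_shift_neq0.
have H4 := exp_bounded_sum (exp_bounded1_recurrence c_rec).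
have H5 := exp_bounded_r (exp_bounded1_exp rho).
have H6 := exp_bounded_r (exp_bounded1_invfact R).
apply: exp_bounded_le (exp_boundedM (exp_boundedM (exp_boundedM (exp_boundedM
  (exp_boundedM H1 H2) H3) H4) H5) H6).
move=> k n; rewrite le_eqVlt; apply/orP; left; apply/eqP; congr `|_|.
rewrite /hyper_factor_term; field.
by rewrite !fact_neq0 poch_s_neq0.
Qed.

Lemma hyper_factor_term_bounded k :
  exists M : R, geometrically_bounded M (hyper_factor_term k).
Proof.
have [M hM] := exp_bounded_fact hyper_factor_term_exp_bounded.
exists (k`!%:R * geometric M 2^-1 k) => n.
have -> : hyper_factor_term k n = k`!%:R *
   (hyper_factor_term k n * ((k + n)`!%:R / k`!%:R) / (k + n)`!%:R).
  by field; rewrite !fact_neq0.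
apply: (@le_trans _ _ (k`!%:R * ofR (geometric M 2^-1 (k + n)))).
  by rewrite normrM normr_nat ler_wpM2l //; exact: hM.
by rewrite -ofR_nat -ofRM ofR_le /= exprD !mulrA.
Qed.

(** The factor (k + n)! gained from c outweighs the exponential growth of all the
    others. *)
Lemma double_term_bounded : exists M : R, forall k n,
  `|double_term k n| <= ofR (geometric M 2^-1 (k + n)).
Proof.
have H1 : exp_bounded1 (fun k => k`!%:R / poch (s + k%:R) k).
  apply: exp_bounded1_le (@exp_bounded1_invpoch R (s + 1) _).
    move=> [|k]; last exact: invpoch_s_le.
    by rewrite !poch0.
  by move=> n; rewrite -addrA nat1r; exact: s_shift_neq0.
have H2 : exp_bounded1 (fun k => k`!%:R / poch (b + 1) k).
  by apply: exp_bounded1_invpoch; exact: ofR1D_shift_neq0.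
have H3 := exp_bounded1_invfact R.
have H4 := exp_bounded1_exp rho.
have H5 := exp_bounded1_jacobi_form g b y_le1 w_le1.
have H := exp_bounded_l (exp_bounded1M (exp_bounded1M (exp_bounded1M
  (exp_bounded1M H1 H2) H3) H4) H5).
have [M hM] := exp_bounded_fact (exp_boundedM H hyper_factor_term_exp_bounded).
exists M => k n; apply: le_trans (hM k n).
rewrite le_eqVlt; apply/orP; left; apply/eqP; congr `|_|.
rewrite /double_term jacobi_formE; field.
by rewrite !fact_neq0 poch_b_neq0 poch_s_neq0.
Qed.

Lemma c_descent m N : (m <= N)%N -> c m = poch (alpha + 1 + m%:R) (N - m) * c N.
Proof.
move=> hm; rewrite -{2}(subnKC hm); elim: (N - m)%N => [|i IH].
  by rewrite poch0 mul1r addn0.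
by rewrite IH c_rec pochS mulrA addnS natrD addrA.
Qed.

(** Both sides are c_N rho^N P_N^(alpha,beta)(x) / (beta + 1)_N: the left by the
    connection formula, the right because c_m = (alpha + 1 + m)_(N-m) c_N. *)
Lemma diagonal_identity N :
  \sum_(0 <= k < N.+1) double_term k (N - k)%N =
  \sum_(0 <= m < N.+1) bessel_term c (- y * rho) m
    * bessel_term (fun n => (poch (b + 1) n)^-1) (w * rho) (N - m)%N.
Proof.
transitivity (rho ^+ N * c N * (jacobi_form N alpha b (1 - w) w / poch (b + 1) N)).
  rewrite (@jacobi_connection _ N alpha b g w); last first.
  - exact: ofR1D_shift_neq0.
  - exact: s_shift_neq0.
  rewrite mulr_sumr !big_nat; apply: eq_bigr => k /andP[_ hk].
  rewrite /double_term /hyper_factor_term jacobi_formE yE subnKC //.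
  have -> : rho ^+ N = rho ^+ k * rho ^+ (N - k) by rewrite -exprD subnKC.
  rewrite -/s -/A; field.
  by rewrite !fact_neq0 poch_b_neq0 !poch_s_neq0.
rewrite -yE /jacobi_form mulr_suml mulr_sumr !big_nat.
apply: eq_bigr => m /andP[_ hm].
have h0 : poch (b + 1 + (N - m)%:R) m != 0.
  have := poch_b_neq0 N; rewrite -{1}(subnK (hm : m <= N)%N) pochD mulf_eq0 negb_or.
  by case/andP.
have -> : poch (b + 1) N = poch (b + 1) (N - m) * poch (b + 1 + (N - m)%:R) m.
  by rewrite -pochD subnK.
have -> : rho ^+ N = rho ^+ m * rho ^+ (N - m) by rewrite -exprD subnKC.
rewrite /bessel_term (c_descent (hm : m <= N)%N) !exprMn; field.
by rewrite !fact_neq0 h0 poch_b_neq0.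
Qed.

Lemma double_term_series :
  series (fun k => csum (double_term k)) K @[K --> \oo] -->
    bessel_series c (- y * rho)
      * bessel_series (fun n => (poch (b + 1) n)^-1) (w * rho).
Proof.
have [M hM] := double_term_bounded.
have [M1 hM1] := bessel_term_bounded (- y * rho) c_rec.
have [M2 hM2] := bessel_term_bounded (w * rho)
  (fun n => invpoch_recurrence n (ofR1D_shift_neq0 beta_gt)).
apply: (iterated_csum hM).
have := csum_cauchy_product hM1 hM2.
suff -> : (fun K : nat => \sum_(0 <= N < K) \sum_(0 <= k < N.+1) double_term k (N - k)%N)
  = (fun K : nat => \sum_(0 <= N < K) \sum_(0 <= k < N.+1)
  bessel_term c (- y * rho) k
    * bessel_term (fun n => (poch (b + 1) n)^-1) (w * rho) (N - k)%N) by [].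
by apply/funext => K; apply: eq_bigr => N _; exact: diagonal_identity.
Qed.

End Expansion.

Section HyperFactor.
Variable R : realType.
Local Notation C := (Cplx R).
Variables (alpha rho : C) (beta gamma : R).
Hypotheses (beta_gt : -1 < beta) (gamma_gt : -1 < gamma).
Hypothesis sum_neq0 : gamma + beta + 1 != 0.

(** The exceptional parameters are real, so that the recurrence of 1 / Gamma on
    the real line covers them. *)
Lemma real_of_nonposint : nonposint (alpha + 1) \/ nonposint (alpha + ofR beta + 1) ->
  exists a : R, alpha = ofR a.
Proof.
move=> [[m hm]|[m hm]].
  by exists (- m%:R - 1); rewrite ofRD !ofRN ofR_nat -hm addrK.
exists (- m%:R - 1 - beta); rewrite !ofRD !ofRN ofR_nat -hm ofR1; ring.
Qed.

(** The continuation in alpha and the quotient defining the generic case are the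
    same series; in the latter ((a+1)/2)_k ((a+2)/2)_k (2k+a+1)_n collapses, for
    a = alpha + beta, to 4^-k (a+1)_k (a+k+1)_n (a+k+n+1)_k. *)
Lemma hyper_factorE k :
  hyper_factor alpha (ofR beta) (ofR gamma) rho k =
  4 ^- k * csum (hyper_factor_term alpha rho beta gamma (inv_gamma_coeff alpha) k).
Proof.
rewrite /hyper_factor; case: asboolP => [/real_of_nonposint[a ea]|].
  have hc i : inv_gamma_coeff alpha i = rgamma (alpha + 1 + i%:R).
    by rewrite ea inv_gamma_coeff_real.
  congr (_ * csum _); apply/funext => n; rewrite /hyper_factor_term hc.
  have -> : alpha + k%:R + n%:R + 1 = alpha + 1 + (k + n)%:R by rewrite natrD; ring.
  have -> : alpha + ofR beta + k%:R + n%:R + 1 = alpha + ofR beta + 1 + (k + n)%:R.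
    by rewrite natrD; ring.
  have -> : ofR gamma + ofR beta + 2 * k%:R + 2 = ofR gamma + ofR beta + 1 + (2 * k).+1%:R.
    by rewrite -[(2 * k).+1%:R]natr1 natrM; ring.
  by [].
move=> /not_orP[/not_nonposint ha /not_nonposint hA].
set A := alpha + ofR beta + 1.
have hAp j n : poch (A + j%:R) n != 0.
  by apply: poch_neq0 => i _; rewrite -addrA -natrD.
have hap n : poch (alpha + 1) n != 0 by apply: poch_neq0.
have hap' j n : poch (alpha + 1 + j%:R) n != 0.
  by apply: poch_neq0 => i _; rewrite -addrA -natrD.
have hsp j n : poch (ofR gamma + ofR beta + 1 + j%:R) n != 0.
  exact: poch_s_neq0.
pose c' n : C := (poch (alpha + 1) n)^-1.
have c'rec n : c' n = (alpha + 1 + n%:R) * c' n.+1 by exact: invpoch_recurrence.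
have [M hM] := hyper_factor_term_bounded rho beta_gt gamma_gt sum_neq0 c'rec k.
(* The first term of the series, for c' instead of c. *)
pose K := poch (A + k%:R) k / poch (alpha + 1) k.
have K0 : K != 0 by rewrite mulf_neq0 ?invr_neq0.
have -> : hyper [:: 2 * k%:R + alpha + ofR beta + 1; alpha - ofR gamma]
      [:: alpha + ofR beta + k%:R + 1; ofR gamma + ofR beta + 2 * k%:R + 2;
          alpha + k%:R + 1] rho
   = K^-1 * csum (hyper_factor_term alpha rho beta gamma c' k).
  rewrite -(csumZ _ hM) /hyper; congr csum; apply/funext => n.
  rewrite /hyper_term !big_cons !big_nil !mulr1 /hyper_factor_term -/A.
  have -> : 2 * k%:R + alpha + ofR beta + 1 = A + k%:R + k%:R by rewrite /A; ring.
  have -> : alpha + ofR beta + k%:R + 1 = A + k%:R by rewrite /A; ring.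
  have -> : alpha + k%:R + 1 = alpha + 1 + k%:R by ring.
  have -> : ofR gamma + ofR beta + 2 * k%:R + 2 = ofR gamma + ofR beta + 1 + (2 * k).+1%:R.
    by rewrite -[(2 * k).+1%:R]natr1 natrM; ring.
  have e : poch (A + k%:R) k * poch (A + k%:R + k%:R) n =
     poch (A + k%:R) n * poch (A + (k + n)%:R) k.
    by rewrite -pochD natrD addrA addnC pochD.
  have e2 : poch (A + k%:R + k%:R) n =
     (poch (A + k%:R) k)^-1 * (poch (A + k%:R) n * poch (A + (k + n)%:R) k).
    by rewrite -e mulKf.
  rewrite e2 /c' pochD /K; field.
  by rewrite !fact_neq0 !hap !hap' !hAp !hsp.
have -> : hyper_factor_term alpha rho beta gamma (inv_gamma_coeff alpha) k =
   (fun n => rgamma (alpha + 1) * hyper_factor_term alpha rho beta gamma c' k n).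
  apply/funext => n; rewrite /hyper_factor_term /inv_gamma_coeff.
  case: asboolP => [[m hm]|_].
    by have := ha m; rewrite hm addNr eqxx.
  rewrite /c'; ring.
rewrite (csumZ _ hM).
have -> : (alpha + ofR beta + 2) / 2 = (A + 1) / 2 by rewrite /A; congr (_ / _); ring.
rewrite -/A poch_double pochD /cgamma /K.
have f4 : (4 : C) ^+ k != 0 by rewrite expf_neq0 // pnatr_eq0.
have A0 : poch A k != 0 by have := hAp 0%N k; rewrite addr0.
move: (csum _) (rgamma _) => u v.
rewrite -[X in _ / (X * _ * _)]/(v^-1) !invfM invrK.
field.
by rewrite f4 hap A0 hAp.
Qed.

Lemma expansion_termE x k :
  expansion_term alpha (ofR beta) (ofR gamma) (ofR x) rho k =
  (ofR gamma + ofR beta + 1) *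
    csum (double_term alpha rho beta gamma x (inv_gamma_coeff alpha) k).
Proof.
have [M hM] := hyper_factor_term_bounded rho beta_gt gamma_gt sum_neq0
  (inv_gamma_coeffS alpha) k.
rewrite /expansion_term hyper_factorE /double_term (csumZ _ hM).
set s := ofR gamma + ofR beta + 1.
have hsp j n : poch (s + j%:R) n != 0 by exact: poch_s_neq0.
have s0 : s != 0 by have := s_shift_neq0 beta_gt gamma_gt sum_neq0 0; rewrite addr0.
have sk : poch s k != 0 by have := hsp 0%N k; rewrite addr0.
have -> : (ofR gamma + ofR beta + 2) / 2 = (s + 1) / 2 by rewrite /s; congr (_ / _); ring.
have -> : (ofR gamma + ofR beta + 3) / 2 = (s + 1 + 1) / 2.
  by rewrite /s; congr (_ / _); ring.
have -> : 2 * k%:R + ofR gamma + ofR beta + 1 = s + (k + k)%:R.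
  by rewrite /s natrD; ring.
rewrite -[poch (ofR beta + 1) k * _ * _]mulrA poch_double.
(* Both are (s)_(2k+1). *)
have e : s * poch (s + 1) (k + k) = poch s k * poch (s + k%:R) k * (s + (k + k)%:R).
  by rewrite -pochSl pochS pochD.
have f4 : (4 : C) ^+ k != 0 by rewrite expf_neq0 // pnatr_eq0.
have b0 : poch (ofR beta + 1) k != 0 by exact: poch_b_neq0.
have p1 : poch (s + 1) (k + k) != 0 by exact: (hsp 1%N).
have e2 : (s + (k + k)%:R) * poch s k = s * poch (s + 1) (k + k) / poch (s + k%:R) k.
  by rewrite e; field.
rewrite e2; field.
by rewrite f4 b0 p1 hsp.
Qed.

End HyperFactor.

(** * The expansion *)

Section Value.
Variable R : realType.
Local Notation C := (Cplx R).

Lemma inv_gamma_coeff_ge (b : R) : -1 < b ->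
  inv_gamma_coeff (ofR b) = (fun n => rgamma (ofR b + 1) * (poch (ofR b + 1) n)^-1).
Proof.
move=> hb; apply/funext => n; rewrite /inv_gamma_coeff; case: asboolP => // -[m hm].
by have := ofR1D_shift_neq0 hb m; rewrite hm addNr eqxx.
Qed.

(** At r = 0 this is the continuity of the two series. *)
Lemma bessel_product_value0 (a b x r : C) : 1 - x != 0 -> 1 + x != 0 ->
  has_value_ext0 (bessel_product a b x) r
    (bessel_series (inv_gamma_coeff a) (- ((1 - x) / 2) * r)
      * bessel_series (inv_gamma_coeff b) ((1 + x) / 2 * r)).
Proof.
move=> h1 h2; rewrite /has_value_ext0; case: eqVneq => [->|r0]; last first.
  exact: bessel_product_series.
apply: (@cvg_trans _ (bessel_series (inv_gamma_coeff a) (- ((1 - x) / 2) * r)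
      * bessel_series (inv_gamma_coeff b) ((1 + x) / 2 * r) @[r --> (0 : C)^'])).
  apply: near_eq_cvg; near=> z; rewrite bessel_product_series //.
  by near: z; exact: nbhs_dnbhs_neq.
by apply: cvgM; exact: bessel_series_continuous0 (inv_gamma_coeffS _).
Unshelve. all: by end_near.
Qed.

End Value.

Theorem theorem2 (R : realType) (alpha : Cplx R) (beta gamma : R)
    (rho : Cplx R) (x : R) :
  -1 < beta -> -1 < gamma ->
  (beta \in `]-1, 0[ -> gamma \in `]-1, 0[ -> beta + gamma + 1 != 0) ->
  `|rho| < 1 ->
  x \in `]-1, 1[ ->
  let t := expansion_term alpha (ofR beta) (ofR gamma) (ofR x) rho in
  cvgn (series t) /\
  has_value_ext0 (bessel_product alpha (ofR beta) (ofR x)) rho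
    (1 / ((ofR gamma + ofR beta + 1) * cgamma (ofR beta + 1)) * csum t).
Proof.
move=> hb hg hbg _ x_itv t.
have hx : -1 < x < 1 by move: x_itv; rewrite in_itv.
have s0 : gamma + beta + 1 != 0.
  have [b0|b0] := ltP beta 0; last by rewrite gt_eqF //; lra.
  have [g0|g0] := ltP gamma 0; last by rewrite gt_eqF //; lra.
  by rewrite [gamma + _]addrC; apply: hbg; rewrite in_itv /= ?hb ?hg.
set b := ofR beta; set s := ofR gamma + b + 1.
have sC : s != 0.
  by have := s_shift_neq0 hb hg s0 0; rewrite addr0.
set J := bessel_series (inv_gamma_coeff alpha) (- ((1 - ofR x) / 2) * rho).
set I' := bessel_series (fun n => (poch (b + 1) n)^-1) ((1 + ofR x) / 2 * rho).
have ht : series t K @[K --> \oo] --> s * (J * I').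
  have -> : series t = (fun K => s * series (fun k => csum (double_term alpha rho
      beta gamma x (inv_gamma_coeff alpha) k)) K).
    apply/funext => K; rewrite /series /= mulr_sumr; apply: eq_bigr => k _.
    exact: expansion_termE.
  apply: cvgM; first exact: cvg_cst.
  exact: double_term_series (inv_gamma_coeffS alpha).
split; first by apply/cvg_ex; eexists; exact: ht.
have -> : csum t = s * (J * I') by exact: limn_unique.
have -> : 1 / (s * cgamma (b + 1)) * (s * (J * I')) =
   J * bessel_series (inv_gamma_coeff b) ((1 + ofR x) / 2 * rho).
  rewrite inv_gamma_coeff_ge //.
  rewrite (bessel_seriesZ _ _ (fun n => invpoch_recurrence n (ofR1D_shift_neq0 hb))).
  rewrite /cgamma -/I' invfM invrK; field; exact: sC.
case/andP: hx => x1 x2.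
by apply: bessel_product_value0; rewrite -?ofRN -ofR1 -ofRD ofR_eq0 gt_eqF //; lra.
Qed.
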